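(* Let $P$ be a locally geometric poset, with associated simplicial poset $S=S(P)$ and independence poset $I=I(P)$. Let $G\subseteq E(P)$ be the set consisting of the following elements, where $\alpha,\beta$ range over $I\setminus\{\hat 0\}$: (i) $e_\alpha e_\beta$ when $\alpha\wedge\beta\neq\{\hat 0\}$, except when $\alpha=\beta$ and $|\alpha|$ is odd; (ii) $e_\alpha e_\beta-\operatorname{sgn}(\alpha,\beta)\sum_{\gamma\in(\alpha\vee\beta)\cap I}e_\gamma$ when $\alpha\wedge\beta=\{\hat 0\}$; (iii) $\sum_{a\in\operatorname{at}(\zeta)}\operatorname{sgn}(a,\omega\setminus a)\,e_{\omega\setminus a}$ when $\omega\in S$ is a $\zeta$-unicircular element. Then $G$ is a Gröbner basis, with respect to the graded-lexicographic order on monomials, for the Orlik–Solomon ideal $J(P)\subseteq E(P)$.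
   Context: All posets are finite. For a poset $P$ and $x\in P$, $P_{\le x}=\{y\in P: y\le x\}$. For $T\subseteq P$, $\bigvee T$ is the set of minimal common upper bounds of $T$ and $\bigwedge T$ the set of maximal common lower bounds; $x\vee y$ and $x\wedge y$ denote the sets $\bigvee\{x,y\}$ and $\bigwedge\{x,y\}$. A lattice is a poset in which all $x\vee y$ and $x\wedge y$ are singletons. A poset with minimum $\hat 0$ is ranked if there is an order-preserving $\rho:P\to\mathbb{Z}_{\ge0}$ with $\rho(\hat 0)=0$ and $\rho(y)=\rho(x)+1$ whenever $y$ covers $x$; $\operatorname{at}(P)$ is the set of rank-one elements (atoms). A geometric lattice is a ranked lattice that is atomic (every element is a join of atoms) and semimodular ($\rho(x)+\rho(y)\ge\rho(x\vee y)+\rho(x\wedge y)$). $P$ is locally geometric if it is ranked, has a minimum $\hat 0$, and $P_{\le x}$ is a geometric lattice for every $x\in P$. For a locally geometric poset $P$, let $S=S(P)=\{(x,T): T\subseteq\operatorname{at}(P),\ x\in\bigvee T\}$, a subposet of $P\times 2^{\operatorname{at}(P)}$ with minimum $\hat 0=(\hat 0,\varnothing)$, and $I=I(P)=\{(x,T)\in S:\rho(x)=|T|\}$ (the independent elements). Each $S_{\le\alpha}$ is a Boolean lattice. For $\alpha=(x,T)\in S$, $\operatorname{at}(\alpha)$ is the set of atoms $(a,\{a\})$, $a\in T$, of $S$ below $\alpha$ (identified with $T$), $|\alpha|=|T|$, and for $a\in\operatorname{at}(\alpha)$, $\alpha\setminus a$ is the unique element of $S_{\le\alpha}$ with atom set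 $\operatorname{at}(\alpha)\setminus\{a\}$. Joins and meets of elements of $S$ are taken in $S$. A circuit is a minimal element of $S\setminus I$; $\omega\in S$ is $\zeta$-unicircular if $\zeta$ is the unique circuit with $\zeta\le\omega$. Fix a linear order $<$ on the atoms. For elements (or sets of atoms) with disjoint atom sets $A,B$, $\operatorname{sgn}(A,B)$ is the sign of the permutation sorting the concatenation of $A$ and $B$ (each listed increasingly) into increasing order. $E(P)$ is the free graded-commutative $\mathbb{Q}$-algebra on generators $e_\alpha$, $\alpha\in I\setminus\{\hat 0\}$, with $\deg e_\alpha=|\alpha|$. The Orlik–Solomon ideal $J(P)\subseteq E(P)$ is the ideal generated by all elements $e_\alpha e_\beta$ with $\alpha\wedge\beta\ne\{\hat 0\}$, together with all elements as in (ii) and (iii) of the claim. Monomial order: choose a linear extension $\le_*$ of $I$ in which $\alpha\le_*\beta$ if either $|\alpha|<|\beta|$, or $|\alpha|=|\beta|$ and the minimal atom (for $<$) in the symmetric difference of $\operatorname{at}(\alpha)$ and $\operatorname{at}(\beta)$ lies in $\operatorname{at}(\beta)$. List $I\setminus\{\hat 0\}$ as $\alpha_1<_*\cdots<_*\alpha_\ell$. The monomials $e_{\alpha_1}^{m_1}\cdots e_{\alpha_\ell}^{m_\ell}$ (with $m_i\ge0$, and $m_i<2$ whenever $|\alpha_i|$ is odd) form a vector space basis of $E(P)$. The monomial with exponent $\bar m$ is smaller than the one with exponent $\bar n$ if it has smaller degree, or the degrees agree and the leftmost nonzero entry of $\bar n-\bar m$ is positive. For nonzero $g$, $\mathrm{LM}(g)$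 is the largest monomial in its support. A finite set $G$ generating an ideal $J$ is a Gröbner basis of $J$ if $\langle \mathrm{LM}(g): g\in G\rangle=\langle\mathrm{LM}(g): g\in J\setminus\{0\}\rangle$ as ideals. *)

(* Defs.v *)
From HB Require Import structures.
From mathcomp Require Import all_boot all_order all_algebra all_fingroup.
From mathcomp Require Import finmap.
From mathcomp.multinomials Require Import monalg.

Set Implicit Arguments.
Unset Strict Implicit.
Unset Printing Implicit Defensive.

Import Order.TTheory GRing.Theory.

Section PosetNotions.
Context {d : Order.disp_t} {P : finPOrderType d}.
Local Open Scope order_scope.

Definition ubounds (T : {set P}) : {set P} := [set u | [forall y in T, y <= u]].
Definition lbounds (T : {set P}) : {set P} := [set l | [forall y in T, l <= y]].

(* [joins T] and [meets T] are sets, possibly empty or with several elements. *)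
Definition joins (T : {set P}) : {set P} :=
  [set x in ubounds T | [forall z in ubounds T, (z <= x) ==> (z == x)]].
Definition meets (T : {set P}) : {set P} :=
  [set x in lbounds T | [forall z in lbounds T, (x <= z) ==> (z == x)]].

Definition lattice : Prop :=
  forall x y : P,
    (exists j, joins [set x; y] = [set j]) /\ (exists m, meets [set x; y] = [set m]).

Definition covers (y x : P) : bool :=
  (x < y) && [forall z, ~~ ((x < z) && (z < y))].

End PosetNotions.

Section RankedPosets.
Context {d : Order.disp_t} {P : finBPOrderType d}.
Local Open Scope order_scope.

Definition rank_function (rho : P -> nat) : Prop :=
  [/\ {homo rho : x y / x <= y >-> (x <= y)%N},
      rho \bot = 0%N
    & forall x y, covers y x -> rho y = (rho x).+1].

Definition atoms (rho : P -> nat) : {set P} := [set a | rho a == 1%N].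

Definition atomic (rho : P -> nat) : Prop :=
  forall x : P, exists2 T : {set P}, T \subset atoms rho & joins T = [set x].

Definition semimodular (rho : P -> nat) : Prop :=
  forall x y j m : P, j \in joins [set x; y] -> m \in meets [set x; y] ->
    (rho j + rho m <= rho x + rho y)%N.

End RankedPosets.

Definition geometric_lattice {d : Order.disp_t} (L : finBPOrderType d) : Prop :=
  @lattice d L /\
  exists rho : L -> nat, [/\ rank_function rho, atomic rho & semimodular rho].

Section DownSets.
Context {d : Order.disp_t} {P : finBPOrderType d}.

Record downset (x : P) := Downset { dval : P; _ : (dval <= x)%O }.

Variable x : P.

HB.instance Definition _ := [isSub for @dval x].
HB.instance Definition _ := [Finite of downset x by <:].
HB.instance Definition _ := [SubChoice_isSubPOrder of downset x by <: with d].

Definition bot_down : downset x := Downset (le0x x).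
Fact le_bot_down (y : downset x) : (bot_down <= y)%O.
Proof. by rewrite leEsub le0x. Qed.
HB.instance Definition _ := Order.hasBottom.Build d (downset x) le_bot_down.

End DownSets.

(* A rank function is unique when it exists, so carrying [rho] as data is the
   same as asking that [P] be ranked. *)
Definition locally_geometric {d : Order.disp_t} {P : finBPOrderType d}
    (rho : P -> nat) : Prop :=
  rank_function rho /\ forall x : P, geometric_lattice (downset x).

Section SimplicialPoset.
Context {d : Order.disp_t} {P : finBPOrderType d}.
Variable rho : P -> nat.

Record simp := Simp {
  simp_val : P * {set P};
  _ : (simp_val.2 \subset atoms rho) && (simp_val.1 \in joins simp_val.2) }.

HB.instance Definition _ := [isSub for simp_val].
HB.instance Definition _ := [Finite of simp by <:].

Definition top_of (a : simp) : P := (simp_val a).1.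
Definition at_of (a : simp) : {set P} := (simp_val a).2.

Definition simp_le (a b : simp) : bool :=
  (top_of a <= top_of b)%O && (at_of a \subset at_of b).

Fact simp_le_refl : reflexive simp_le.
Proof. by move=> a; rewrite /simp_le lexx subxx. Qed.
Fact simp_le_anti : antisymmetric simp_le.
Proof.
move=> a b /andP[/andP[ab sab] /andP[ba sba]]; apply/val_inj => /=.
rewrite (surjective_pairing (simp_val a)) (surjective_pairing (simp_val b)).
congr (_, _); first by apply/le_anti; rewrite ab ba.
by apply/eqP; rewrite eqEsubset sab.
Qed.
Fact simp_le_trans : transitive simp_le.
Proof.
move=> b a c /andP[ab sab] /andP[bc sbc].
by rewrite /simp_le (le_trans ab bc) (subset_trans sab sbc).
Qed.
HB.instance Definition _ :=
  Order.Le_isPOrder.Build d simp simp_le_refl simp_le_anti simp_le_trans.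

Fact bot_simp_proof :
  ((set0 : {set P}) \subset atoms rho) && (\bot%O \in joins (set0 : {set P})).
Proof.
rewrite sub0set !inE /=; apply/andP; split.
  by apply/forall_inP => y; rewrite inE.
by apply/forall_inP => z _; rewrite lex0; apply/implyP.
Qed.
Definition bot_simp : simp := @Simp (\bot%O, set0) bot_simp_proof.
Fact le_bot_simp (a : simp) : (bot_simp <= a)%O.
Proof. by apply/andP; split; [exact: le0x | exact: sub0set]. Qed.
HB.instance Definition _ := Order.hasBottom.Build d simp le_bot_simp.

Definition indep (a : simp) : bool := rho (top_of a) == #|at_of a|.

End SimplicialPoset.
Local Open Scope ring_scope.

(* The free graded-commutative algebra on generators [k : K] of degree [deg k],
   built on its basis of monomials: exponent vectors [m] with [m k < 2] when
   [deg k] is odd.  Its universal property is [gc_free] below. *)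
Section FreeGradedCommutative.
Variables (R : fieldType) (K : finType) (deg : K -> nat).

Definition reduced (m : {ffun K -> nat}) : bool :=
  [forall k, odd (deg k) ==> (m k < 2)%N].

Record rexp := RExp { expo :> {ffun K -> nat}; _ : reduced expo }.
HB.instance Definition _ := [isSub for expo].
HB.instance Definition _ := [Choice of rexp by <:].

Definition gcalg : Type := {malg R[rexp]}.
HB.instance Definition _ := GRing.Lmodule.on gcalg.

Definition expD (m n : {ffun K -> nat}) : {ffun K -> nat} :=
  [ffun k => (m k + n k)%N].

(* Sign exponent incurred by reordering the product of the monomials [m] and [n]:
   each factor [j] of [n] moves past the factors [i] of [m] with [j] before [i]
   in the order of [enum K]. *)
Definition gc_inv (m n : {ffun K -> nat}) : nat :=
  (\sum_i \sum_(j | enum_rank j < enum_rank i) m i * deg i * (n j * deg j))%N.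

(* Zero when an odd generator would occur with exponent at least 2. *)
Definition gc_monom (c : R) (m : {ffun K -> nat}) : gcalg :=
  if (insub m : option rexp) is Some r then << c *g r >> else 0.

Definition gc_mul (g h : gcalg) : gcalg :=
  \sum_(m <- msupp g) \sum_(n <- msupp h)
    gc_monom (g@_m * h@_n * (-1) ^+ gc_inv m n) (expD m n).

Definition gc_one : gcalg := gc_monom 1 [ffun=> 0%N].

Definition gc_lift (V : lmodType R) (f : rexp -> V) (g : gcalg) : V :=
  \sum_(m <- msupp g) g@_m *: f m.

Lemma gc_monomZ c d m : gc_monom (c * d) m = c *: gc_monom d m.
Proof.
rewrite /gc_monom; case: insub => [r|]; last by rewrite scaler0.
apply/malgP => k; rewrite mcoeffZ (mcoeffU r (c * d)) (mcoeffU r d).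
by case: (r == k); [rewrite !mulr1n | rewrite !mulr0n mulr0].
Qed.

Lemma gc_monomE c (r : rexp) : gc_monom c r = << c *g r >>.
Proof. by rewrite /gc_monom valK. Qed.

Lemma gc_monomN c m : ~~ reduced m -> gc_monom c m = 0.
Proof. by move=> nr; rewrite /gc_monom insubN. Qed.

Lemma gc_liftw (V : lmodType R) (f : rexp -> V) (g : gcalg) (D : {fset rexp}) :
  (msupp g `<=` D)%fset -> gc_lift f g = \sum_(m <- D) g@_m *: f m.
Proof.
move=> sD; rewrite /gc_lift; apply: big_fset_incl => // m _ mg.
by rewrite mcoeff_outdom ?scale0r.
Qed.

Lemma gc_lift_linear (V : lmodType R) (f : rexp -> V) : linear (gc_lift f).
Proof.
move=> c g1 g2; pose D := (msupp g1 `|` msupp g2 `|` msupp (c *: g1 + g2)%R)%fset.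
rewrite !(@gc_liftw _ f _ D) ?fsubsetUr //; first last.
- by rewrite /D -fsetUA fsubsetUl.
- by rewrite /D fsetUAC fsubsetUr.
rewrite scaler_sumr -big_split /=; apply: eq_bigr => m _.
by rewrite mcoeffD mcoeffZ scalerDl scalerA.
Qed.
HB.instance Definition _ (V : lmodType R) (f : rexp -> V) :=
  GRing.isLinear.Build R gcalg V _ (gc_lift f) (gc_lift_linear f).

Lemma gc_liftU (V : lmodType R) (f : rexp -> V) c m :
  gc_lift f << c *g m >> = c *: f m.
Proof.
by rewrite (@gc_liftw _ _ _ [fset m]%fset) ?msuppU_le // big_seq_fset1 mcoeffUU.
Qed.

Lemma gc_lift_comp (V : lmodType R) (f : rexp -> V) (h : rexp -> gcalg) g :
  gc_lift f (gc_lift h g) = gc_lift (fun m => gc_lift f (h m)) g.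
Proof.
rewrite {2}/gc_lift linear_sum; apply: eq_bigr => m _.
by rewrite linearZ.
Qed.

Lemma gc_lift_exch (V : lmodType R) (f : rexp -> rexp -> V) g h :
  gc_lift (fun m => gc_lift (f m) h) g =
  gc_lift (fun n => gc_lift (f^~ n) g) h.
Proof.
rewrite /gc_lift; under eq_bigr do rewrite scaler_sumr.
rewrite exchange_big; apply: eq_bigr => n _; rewrite scaler_sumr.
by apply: eq_bigr => m _; rewrite !scalerA mulrC.
Qed.

Lemma eq_gc_lift (V : lmodType R) (f1 f2 : rexp -> V) g :
  f1 =1 f2 -> gc_lift f1 g = gc_lift f2 g.
Proof. by move=> e; apply: eq_bigr => m _; rewrite e. Qed.

Definition gc_mulU (m n : rexp) : gcalg :=
  gc_monom ((-1) ^+ gc_inv m n) (expD m n).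

Lemma gc_mulE g h : gc_mul g h = gc_lift (fun m => gc_lift (gc_mulU m) h) g.
Proof.
apply: eq_bigr => m _; rewrite scaler_sumr; apply: eq_bigr => n _.
by rewrite scalerA gc_monomZ.
Qed.

Lemma expDA : associative expD.
Proof. by move=> m n p; apply/ffunP => k; rewrite !ffunE addnA. Qed.
Lemma expDC : commutative expD.
Proof. by move=> m n; apply/ffunP => k; rewrite !ffunE addnC. Qed.

Lemma reducedDl m n : reduced (expD m n) -> reduced m.
Proof.
move=> /forallP r; apply/forallP => k; apply/implyP => /(implyP (r k)).
by rewrite ffunE; apply: leq_ltn_trans; rewrite leq_addr.
Qed.

Lemma gc_invDl m n p : gc_inv (expD m n) p = (gc_inv m p + gc_inv n p)%N.
Proof.
rewrite -big_split; apply: eq_bigr => i _; rewrite -big_split.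
by apply: eq_bigr => j _; rewrite ffunE !mulnDl.
Qed.
Lemma gc_invDr m n p : gc_inv m (expD n p) = (gc_inv m n + gc_inv m p)%N.
Proof.
rewrite -big_split; apply: eq_bigr => i _; rewrite -big_split.
by apply: eq_bigr => j _; rewrite ffunE mulnDl mulnDr.
Qed.

Lemma gc_lift_monom (V : lmodType R) (f : rexp -> V) c m (rm : reduced m) :
  gc_lift f (gc_monom c m) = c *: f (RExp rm).
Proof. by rewrite (gc_monomE c (RExp rm)) gc_liftU. Qed.

Lemma gc_lift_monomN (V : lmodType R) (f : rexp -> V) c m :
  ~~ reduced m -> gc_lift f (gc_monom c m) = 0.
Proof. by move=> nr; rewrite gc_monomN // linear0. Qed.

Lemma gc_mulUA (m n p : rexp) :
  gc_lift (gc_mulU m) (gc_mulU n p) = gc_lift (gc_mulU^~ p) (gc_mulU m n).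
Proof.
rewrite /gc_mulU; case: (boolP (reduced (expD m (expD n p)))) => [r|nr].
  have rnp : reduced (expD n p) by move: r; rewrite expDC => /reducedDl.
  have rmn : reduced (expD m n) by move: r; rewrite expDA => /reducedDl.
  rewrite (gc_lift_monom _ _ rnp) (gc_lift_monom _ _ rmn) /=.
  rewrite -(gc_monomZ _ _ (expD m _)) -(gc_monomZ _ _ (expD (expD _ _) _)) -!exprD.
  rewrite gc_invDl gc_invDr expDA.
  by congr (gc_monom (_ ^+ _) _); rewrite addnC -addnA.
have L : gc_lift (gc_mulU^~ p) (gc_monom ((-1) ^+ gc_inv m n) (expD m n)) = 0.
  have [rmn|?] := boolP (reduced (expD m n)); last by rewrite gc_lift_monomN.
  by rewrite (gc_lift_monom _ _ rmn) /gc_mulU gc_monomN ?scaler0 //= -expDA.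
rewrite L; have [rnp|?] := boolP (reduced (expD n p)).
  by rewrite (gc_lift_monom _ _ rnp) gc_monomN ?scaler0.
by rewrite gc_lift_monomN.
Qed.

Lemma gc_mulA : associative gc_mul.
Proof.
move=> g h k; rewrite !gc_mulE gc_lift_comp; apply: eq_gc_lift => m.
rewrite !gc_lift_comp; apply: eq_gc_lift => n.
by rewrite gc_lift_comp gc_lift_exch; apply: eq_gc_lift => p; apply: gc_mulUA.
Qed.

Lemma gc_inv0l m : gc_inv [ffun=> 0%N] m = 0%N.
Proof. by rewrite /gc_inv big1 // => i _; rewrite big1 // => j _; rewrite ffunE. Qed.
Lemma gc_inv0r m : gc_inv m [ffun=> 0%N] = 0%N.
Proof.
by rewrite /gc_inv big1 // => i _; rewrite big1 // => j _; rewrite ffunE muln0.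
Qed.
Lemma expD0l m : expD [ffun=> 0%N] m = m.
Proof. by apply/ffunP => k; rewrite !ffunE. Qed.

Lemma reduced0 : reduced [ffun=> 0%N].
Proof. by apply/forallP => k; rewrite ffunE implybT. Qed.

Lemma gc_lift_id g : gc_lift (fun m => gc_monom 1 m) g = g.
Proof.
rewrite [RHS]monalgE; apply: eq_bigr => m _.
by rewrite -gc_monomZ gc_monomE mulr1.
Qed.

Lemma gc_mul1g : left_id gc_one gc_mul.
Proof.
move=> g; rewrite gc_mulE /gc_one (gc_lift_monom _ _ reduced0) scale1r -[RHS]gc_lift_id; apply: eq_gc_lift => m.
by rewrite /gc_mulU /= gc_inv0l expD0l.
Qed.

Lemma gc_mulg1 : right_id gc_one gc_mul.
Proof.
move=> g; rewrite gc_mulE -[RHS]gc_lift_id; apply: eq_gc_lift => m.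
rewrite /gc_one (gc_lift_monom _ _ reduced0) scale1r.
by rewrite /gc_mulU /= gc_inv0r expDC expD0l.
Qed.

Lemma gc_mulDl : left_distributive gc_mul +%R.
Proof. by move=> g1 g2 h; rewrite !gc_mulE linearD. Qed.
Lemma gc_mulZl c g h : c *: gc_mul g h = gc_mul (c *: g) h.
Proof. by rewrite !gc_mulE linearZ. Qed.
Lemma gc_mulDr : right_distributive gc_mul +%R.
Proof.
move=> g h1 h2; rewrite !gc_mulE -big_split; apply: eq_bigr => m _.
by rewrite linearD scalerDr.
Qed.
Lemma gc_mulZr c g h : c *: gc_mul g h = gc_mul g (c *: h).
Proof.
rewrite !gc_mulE scaler_sumr; apply: eq_bigr => m _.
by rewrite scalerA mulrC -scalerA; congr (_ *: _); rewrite linearZ.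
Qed.

Lemma gc_one_neq0 : gc_one != 0.
Proof.
rewrite /gc_one (gc_monomE 1 (RExp reduced0)).
by rewrite monalgU_eq0 oner_eq0.
Qed.

HB.instance Definition _ := GRing.Zmodule_isNzRing.Build gcalg
  gc_mulA gc_mul1g gc_mulg1 gc_mulDl gc_mulDr gc_one_neq0.
HB.instance Definition _ := GRing.Lmodule_isLalgebra.Build R gcalg gc_mulZl.
HB.instance Definition _ := GRing.Lalgebra_isAlgebra.Build R gcalg gc_mulZr.

Definition gc_gen (k : K) : gcalg := gc_monom 1 [ffun i => (i == k : nat)].


Section Universal.
Variables (A : algType R) (f : K -> A).
Hypothesis f_comm : forall i j, f i * f j = (-1) ^+ (deg i * deg j) *: (f j * f i).
Hypothesis f_odd : forall k, odd (deg k) -> f k ^+ 2 = 0.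

Let scomm (e : nat) (x y : A) : Prop := x * y = (-1) ^+ e *: (y * x).

Lemma scomm1l y : scomm 0 1 y.
Proof. by rewrite /scomm mul1r mulr1 scale1r. Qed.

Lemma scommMl e1 e2 x1 x2 y :
  scomm e1 x1 y -> scomm e2 x2 y -> scomm (e1 + e2) (x1 * x2) y.
Proof.
move=> h1 h2; rewrite /scomm -mulrA h2 -scalerAr (mulrA x1) h1 -scalerAl scalerA.
by rewrite -exprD addnC mulrA.
Qed.

Lemma scommC e x y : scomm e x y -> scomm e y x.
Proof. by rewrite /scomm => ->; rewrite scalerA -expr2 sqrr_sign scale1r. Qed.

Lemma scommXl e n x y : scomm e x y -> scomm (n * e) (x ^+ n) y.
Proof.
move=> h; elim: n => [|n IH]; first exact: scomm1l.
by rewrite exprS mulSn; apply: scommMl.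
Qed.

Lemma scommXX i j a b : scomm (a * deg i * (b * deg j)) (f i ^+ a) (f j ^+ b).
Proof.
have -> : (a * deg i * (b * deg j) = a * (b * (deg i * deg j)))%N.
  by rewrite -!mulnA; congr (_ * _)%N; rewrite mulnCA.
by apply: scommXl; apply: scommC; apply: scommXl; apply: scommC; apply: f_comm.
Qed.

Definition fprod_seq (s : seq K) (m : {ffun K -> nat}) : A :=
  \prod_(k <- s) f k ^+ m k.

Lemma scomm_prod s (m : {ffun K -> nat}) k b :
  scomm (\sum_(i <- s) m i * deg i * (b * deg k))%N (fprod_seq s m) (f k ^+ b).
Proof.
rewrite /fprod_seq; elim: s => [|i s IH]; first by rewrite !big_nil; apply: scomm1l.
by rewrite !big_cons; apply: scommMl => //; apply: scommXX.
Qed.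

Let ltr : rel K := fun j i => (enum_rank j < enum_rank i)%N.

Lemma fprod_seqM s (m n : {ffun K -> nat}) : pairwise ltr s ->
  fprod_seq s m * fprod_seq s n =
  (-1) ^+ (\sum_(i <- s) \sum_(j <- s | ltr j i) m i * deg i * (n j * deg j))%N
    *: fprod_seq s (expD m n).
Proof.
elim: s => [|k s IH] /=; first by rewrite /fprod_seq !big_nil mulr1 scale1r.
case/andP => ks ps.
have ltkk : ltr k k = false by rewrite /ltr ltnn.
rewrite /fprod_seq !big_cons -!/(fprod_seq s _) ltkk.
rewrite [X in (X + _)%N]big1_seq; last first.
  move=> j /andP[lj js]; have := allP ks j js.
  by rewrite /ltr ltnNge ltnW.
rewrite add0n.
rewrite (eq_big_seq (fun i => m i * deg i * (n k * deg k) +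
   \sum_(j <- s | ltr j i) m i * deg i * (n j * deg j))%N); last first.
  by move=> i si; rewrite big_cons (allP ks i si).
rewrite big_split exprD -scalerA -mulrA [X in _ * X]mulrA.
rewrite (scomm_prod s m k (n k)) -scalerAl -scalerAr -!mulrA IH //.
by rewrite -!scalerAr ffunE exprD !mulrA.
Qed.

Definition fprod : {ffun K -> nat} -> A := fprod_seq (enum K).


Lemma fprodN m : ~~ reduced m -> fprod m = 0.
Proof.
rewrite negb_forall => /existsP[k]; rewrite negb_imply -leqNgt => /andP[ok mk].
have : k \in enum K by rewrite mem_enum.
rewrite /fprod /fprod_seq; elim: (enum K) => // i s IH; rewrite inE big_cons.
case: eqP => [<- _|_ /IH ->]; last by rewrite mulr0.
by rewrite -(subnK mk) exprD f_odd // mulr0 mul0r.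
Qed.

Definition gc_map : gcalg -> A := gc_lift (fun m : rexp => fprod m).

Lemma gc_map_monom c m : gc_map (gc_monom c m) = c *: fprod m.
Proof.
have [rm|nr] := boolP (reduced m); first by rewrite /gc_map (gc_lift_monom _ _ rm).
by rewrite fprodN // scaler0 /gc_map gc_lift_monomN.
Qed.

Lemma gc_map_mul : pairwise ltr (enum K) -> {morph gc_map : x y / x * y}.
Proof.
move=> pK g h.
rewrite /gc_map [g * h]gc_mulE gc_lift_comp [in RHS]/gc_lift mulr_suml -!/(gc_lift _ _).
apply: eq_bigr => m _; rewrite -scalerAl; congr (_ *: _).
rewrite gc_lift_comp [gc_lift _ h in RHS]/gc_lift mulr_sumr; apply: eq_bigr => n _.
rewrite -scalerAr; congr (_ *: _); rewrite -/(gc_map _) gc_map_monom.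
rewrite /fprod fprod_seqM //; congr (_ ^+ _ *: _).
by rewrite big_enum /=; apply: eq_bigr => i _; rewrite big_enum_cond.
Qed.

Lemma gc_map1 : gc_map 1 = 1.
Proof.
have -> : (1 : gcalg) = gc_monom 1 [ffun=> 0%N] by [].
rewrite gc_map_monom scale1r /fprod /fprod_seq.
by rewrite big1 // => k _; rewrite ffunE expr0.
Qed.

Lemma gc_map_gen k : gc_map (gc_gen k) = f k.
Proof.
rewrite gc_map_monom scale1r /fprod /fprod_seq.
have one i0 s : i0 \notin s ->
    \prod_(i <- s) f i ^+ [ffun i => (i == i0 : nat)] i = 1.
  move=> ks; rewrite big1_seq // => i /andP[_ si]; rewrite ffunE.
  by case: eqP => // ik; rewrite -ik si in ks.
have : k \in enum K by rewrite mem_enum.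
elim: (enum K) (enum_uniq K) => // i s IH /= /andP[si us].
rewrite inE big_cons; case: (eqVneq k i) => [->|ki] /=.
  by rewrite one // ffunE eqxx expr1 mulr1.
by move=> ks; rewrite ffunE eq_sym (negPf ki) expr0 mul1r IH.
Qed.

End Universal.

Lemma gc_enum_pairwise :
  pairwise (fun j i : K => (enum_rank j < enum_rank i)%N) (enum K).
Proof.
case E : (enum K) => [|x0 s] //; rewrite -E; apply/(pairwiseP x0) => i j.
have rk k : k \in [pred i | (i < size (enum K))%N] ->
    enum_rank (nth x0 (enum K) k) = k :> nat.
  rewrite inE -cardE => kK.
  by rewrite -[k]/(nat_of_ord (Ordinal kK)) -(enum_val_nth x0) enum_valK.
by move=> si sj ij; rewrite !rk.
Qed.

Lemma gc_monomM c d m n :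
  gc_monom c m * gc_monom d n = gc_monom (c * d * (-1) ^+ gc_inv m n) (expD m n).
Proof.
have [rm|nr] := boolP (reduced m); last first.
  rewrite [X in X * _]gc_monomN // mul0r gc_monomN //.
  by apply: contra nr; apply: reducedDl.
have [rn|nr] := boolP (reduced n); last first.
  rewrite [X in _ * X]gc_monomN // mulr0 gc_monomN // expDC.
  by apply: contra nr; apply: reducedDl.
rewrite [LHS]gc_mulE (gc_lift_monom _ _ rm) (gc_lift_monom _ _ rn).
by rewrite scalerA [RHS]gc_monomZ.
Qed.

Lemma gc_inv_gen (i j : K) a b :
  gc_inv [ffun k => (a * (k == i))%N] [ffun k => (b * (k == j))%N] =
  if (enum_rank j < enum_rank i)%N then (a * deg i * (b * deg j))%N else 0%N.
Proof.
rewrite /gc_inv (bigD1 i) //= [X in (_ + X)%N]big1 ?addn0; last first.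
  by move=> k /negPf ki; rewrite big1 // => l _; rewrite !ffunE ki muln0.
case: ifP => [ji|ij]; last first.
  rewrite big1 // => l li; rewrite !ffunE; case: (eqVneq l j) => [lj|_].
    by rewrite -lj li in ij.
  by rewrite !muln0.
rewrite (bigD1 j) //= [X in (_ + X)%N]big1 ?addn0; last first.
  by move=> l /andP[_ /negPf lj]; rewrite !ffunE lj !muln0.
by rewrite !ffunE !eqxx !muln1.
Qed.

Let gen1 (k : K) : [ffun i => (i == k : nat)] = [ffun i => (1 * (i == k))%N].
Proof. by apply/ffunP => i; rewrite !ffunE mul1n. Qed.

Lemma gc_gen_odd k : odd (deg k) -> gc_gen k ^+ 2 = 0.
Proof.
move=> ok; rewrite expr2 gc_monomM gc_monomN // negb_forall; apply/existsP; exists k.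
by rewrite !ffunE eqxx ok.
Qed.

Lemma gc_gen_comm i j :
  gc_gen i * gc_gen j = (-1) ^+ (deg i * deg j) *: (gc_gen j * gc_gen i).
Proof.
case: (eqVneq i j) => [->|ij].
  case: (boolP (odd (deg j))) => [oj|ej]; first by rewrite -expr2 gc_gen_odd // scaler0.
  by rewrite -signr_odd oddM (negPf ej) scale1r.
rewrite /gc_gen !gen1 !gc_monomM -gc_monomZ expDC !gc_inv_gen !mul1n !mul1r.
congr (gc_monom _ _); case: (ltngtP (enum_rank i) (enum_rank j)) => [||e].
- by rewrite mulnC -expr2 sqrr_sign.
- by rewrite expr0 mulr1.
- by case/negP: ij; apply/eqP/enum_rank_inj/val_inj.
Qed.

Lemma gc_genX k a : gc_gen k ^+ a = gc_monom 1 [ffun i => (a * (i == k))%N].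
Proof.
elim: a => [|a IH].
  by rewrite expr0 [LHS]/(gc_monom 1 _); congr gc_monom; apply/ffunP => i; rewrite !ffunE.
rewrite exprS IH /gc_gen gen1 gc_monomM gc_inv_gen ltnn expr0 !mulr1.
by congr gc_monom; apply/ffunP => i; rewrite !ffunE -mulnDl.
Qed.

Lemma gc_monom_prod (m : {ffun K -> nat}) :
  gc_monom 1 m = \prod_(k <- enum K) gc_gen k ^+ m k.
Proof.
pose r := fun j i : K => (enum_rank j < enum_rank i)%N.
have H s : uniq s -> pairwise r s -> \prod_(k <- s) gc_gen k ^+ m k =
    gc_monom 1 [ffun k => (m k * (k \in s))%N].
  elim: s => [|k s IH] /=.
    rewrite big_nil => _ _; rewrite [LHS]/(gc_monom 1 _); congr gc_monom.
    by apply/ffunP => i; rewrite !ffunE muln0.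
  move=> /andP[ks us] /andP[aks ps]; rewrite big_cons IH // gc_genX gc_monomM.
  rewrite /gc_inv big1 => [|i _]; last first.
    rewrite big1 // => j ji; rewrite !ffunE; case: (eqVneq i k) => [ik|]; last by rewrite muln0.
    case: (boolP (j \in s)) => [js|]; last by rewrite !muln0.
    by have := allP aks j js; rewrite /r -ik ltnNge ltnW.
  rewrite expr0 !mulr1; congr gc_monom; apply/ffunP => i; rewrite !ffunE inE.
  by case: (eqVneq i k) => [->|_]; rewrite ?(negPf ks) ?muln0 ?muln1 ?addn0.
rewrite H ?enum_uniq ?gc_enum_pairwise //; congr gc_monom.
by apply/ffunP => k; rewrite ffunE mem_enum muln1.
Qed.

Theorem gc_free (A : algType R) (f : K -> A) :
    (forall i j, f i * f j = (-1) ^+ (deg i * deg j) *: (f j * f i)) ->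
    (forall k, odd (deg k) -> f k ^+ 2 = 0) ->
  (exists phi : {lrmorphism gcalg -> A}, forall k, phi (gc_gen k) = f k) /\
  (forall phi psi : {lrmorphism gcalg -> A},
     (forall k, phi (gc_gen k) = f k) -> (forall k, psi (gc_gen k) = f k) ->
     phi =1 psi).
Proof.
move=> fC fO; split.
  pose ml := gc_lift_linear (fun m : rexp => fprod f m).
  pose l := GRing.isLinear.Build R gcalg A _ (gc_map f) ml.
  pose mm := GRing.isMonoidMorphism.Build gcalg A (gc_map f)
    (gc_map1 fO, gc_map_mul fC fO gc_enum_pairwise).
  pose phi : {lrmorphism gcalg -> A} := HB.pack (gc_map f) l mm.
  by exists phi => k; apply: (gc_map_gen fO).
move=> phi psi fphi fpsi g; rewrite -(gc_lift_id g) !linear_sum.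
apply: eq_bigr => m _; rewrite !linearZ; congr (_ *: _).
rewrite gc_monom_prod !rmorph_prod; apply: eq_bigr => k _.
by rewrite !rmorphXn /= fphi fpsi.
Qed.

End FreeGradedCommutative.

Section Groebner.
Context {R : fieldType} {K : finType} {deg : K -> nat}.
Local Notation E := (gcalg R deg).

(* Two-sided ideal generated by [G]. *)
Inductive ideal (G : E -> Prop) : E -> Prop :=
| ideal_gen g : G g -> ideal G g
| ideal_zero : ideal G 0
| ideal_add g h : ideal G g -> ideal G h -> ideal G (g + h)
| ideal_mull a g : ideal G g -> ideal G (a * g)
| ideal_mulr g a : ideal G g -> ideal G (g * a).

Variable le : rel K.

Definition monom_deg (m : rexp deg) : nat := (\sum_k m k * deg k)%N.

Definition monom_lt (m n : rexp deg) : bool :=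
  (monom_deg m < monom_deg n)%N ||
  (monom_deg m == monom_deg n) &&
  [exists k, (m k < n k)%N && [forall j, (j != k) ==> le j k ==> (m j == n j)]].

Definition monom (m : rexp deg) : E :=
  \prod_(k <- sort le (enum K)) gc_gen R deg k ^+ m k.

(* [msupp g] refers to the basis of monomials whose factors are listed in the
   order of [enum K]; each of these equals [monom m] up to sign, so the support
   of [g] and its leading monomial do not depend on that enumeration. *)
Definition leading_monom (g M : E) : Prop :=
  exists m : rexp deg,
    [/\ m \in msupp g, {in msupp g, forall n, n != m -> monom_lt n m} & M = monom m].

Definition leading_monoms (G : E -> Prop) (M : E) : Prop :=
  exists g, [/\ G g, g != 0 & leading_monom g M].

Definition groebner_basis (G J : E -> Prop) : Prop :=
  [/\ exists s : seq E, forall g, G g -> g \in s,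
      forall x, ideal G x <-> J x
    & forall x, ideal (leading_monoms G) x <-> ideal (leading_monoms J) x].

End Groebner.

Definition linear_order_on {T : Type} (A : {pred T}) (r : rel T) : Prop :=
  [/\ {in A &, total r}, {in A &, antisymmetric r} & {in A & &, transitive r}].

(* For a duplicate-free [s] and a linear order [r] there is exactly one such
   permutation. *)
Definition sorting_perm {T : eqType} (r : rel T) (s : seq T) : 'S_(size s) :=
  odflt 1%g
    [pick p : 'S_(size s) | sorted r [seq tnth (in_tuple s) (p i) | i <- enum 'I_(size s)]].

Definition shuffle_sgn {T : finType} (r : rel T) (A B : {set T}) : rat :=
  (-1) ^+ odd_perm (sorting_perm r (sort r (enum A) ++ sort r (enum B))).

Section OrlikSolomon.
Context {d : Order.disp_t} {P : finBPOrderType d} (rho : P -> nat).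
Local Notation S := (simp rho).
Variable lea : rel P.

(* The join with the atom set of [a] minus [x] below [a]; it is unique when [P]
   is locally geometric. *)
Definition del (a : S) (x : P) : S :=
  odflt \bot%O [pick b : S | (b <= a)%O && (at_of b == at_of a :\ x)].

Definition circuit (z : S) : bool :=
  ~~ indep z && [forall y : S, ~~ indep y ==> (y <= z)%O ==> (y == z)].

Definition unicircular (z w : S) : bool :=
  [&& circuit z, (z <= w)%O & [forall y : S, circuit y ==> (y <= w)%O ==> (y == z)]].

Definition indep_pos (a : S) : bool := indep a && (a != \bot%O).
Definition osgen : finType := {a : S | indep_pos a}.

Definition osalg := gcalg rat (fun k : osgen => #|at_of (val k)|).

(* Zero by convention outside of the independent elements other than the minimum,
   where it is never used. *)
Definition os_e (a : S) : osalg :=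
  if (insub a : option osgen) is Some k then gc_gen rat _ k else 0.

Definition os_sgn (A B : {set P}) : rat := shuffle_sgn lea A B.

Definition os_mono (g : osalg) : Prop :=
  exists a b : S, [/\ indep_pos a, indep_pos b,
    meets [set a; b] != [set \bot%O] & g = os_e a * os_e b].

Definition os_mono_nz (g : osalg) : Prop :=
  exists a b : S, [/\ indep_pos a, indep_pos b,
    meets [set a; b] != [set \bot%O], ~~ ((a == b) && odd #|at_of a|)
    & g = os_e a * os_e b].

Definition os_join (g : osalg) : Prop :=
  exists a b : S, [/\ indep_pos a, indep_pos b,
    meets [set a; b] = [set \bot%O]
    & g = os_e a * os_e b
          - os_sgn (at_of a) (at_of b) *:
              \sum_(c in joins [set a; b] | indep c) os_e c].

Definition os_circ (g : osalg) : Prop :=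
  exists z w : S, unicircular z w /\
    g = \sum_(x in at_of z)
          os_sgn [set x] (at_of (del w x)) *: os_e (del w x).

Definition os_basis (g : osalg) : Prop := [\/ os_mono_nz g, os_join g | os_circ g].

Definition os_ideal : osalg -> Prop :=
  ideal (fun g => [\/ os_mono g, os_join g | os_circ g]).

Definition star_order (les : rel S) : Prop :=
  [/\ linear_order_on (@indep d P rho) les,
      {in @indep d P rho &, forall a b, (a <= b)%O -> les a b},
      {in @indep d P rho &, forall a b, (#|at_of a| < #|at_of b|)%N -> les a b}
    & {in @indep d P rho &, forall a b, #|at_of a| = #|at_of b| ->
        (exists2 x, x \in at_of b :\: at_of a &
           forall y, y \in (at_of a :\: at_of b) :|: (at_of b :\: at_of a) -> lea x y) ->
        les a b}].

Definition osgen_le (les : rel S) : rel osgen := relpre val les.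

End OrlikSolomon.

(* Main.v *)
Require Import Defs.
From HB Require Import structures.
From mathcomp Require Import all_boot all_order all_algebra all_fingroup.
From mathcomp Require Import finmap.
From mathcomp.multinomials Require Import monalg.

Set Implicit Arguments.
Unset Strict Implicit.
Unset Printing Implicit Defensive.

Import Order.TTheory GRing.Theory.

(** The elements of G lie in J and generate it, so the point is that no nonzero
    element of J has a leading monomial outside the ideal generated by the leading
    monomials of G.

    Every monomial with two factors is divisible by a leading monomial of G: a
    product of two generators is either in G or is the leading term of a join
    relation, because products of smaller generators beat single generators of the
    same degree ([leading_pair]).  Only 1 and the single generators remain.  Write
    alpha = (x, A) for an independent element, with alpha = bottom standing for the
    monomial 1.  If some atom t below x depends on the elements of A that are larger
    than t, then (x, A + t) has nullity one, hence is unicircular, its circuit has t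
    as smallest atom, and the corresponding circuit relation has e_alpha as leading
    term ([broken_circuit_unicircular], [leading_circuit]).  Otherwise alpha
    contains no broken circuit ([nbc]).

    It remains to see that such an alpha is never the leading monomial of an element
    of J.  Adding the elements of A one at a time, from the largest to the smallest,
    gives a maximal flag of P below x, with one element of A in each layer (step) of
    the flag.  Send an atom below x to the element of A in its layer, and e_beta,
    for beta = (y, T) with y below x, to the product of the images of the elements
    of T in the exterior algebra on the atoms; send e_beta to 0 when y is not below
    x.  Sets with at most one element in each layer are independent
    ([layer_inj_indep_set]), so dependent sets are sent to 0.  From this, the
    resulting algebra morphism, [restrict_val], kills J ([restrict_ideal]): the join
    relations because a single join of beta and gamma lies below x, and the circuit
    relations because they become the boundary of a vanishing product
    ([wedge_boundary]).

    The morphism sends e_alpha to plus or minus the product of the elements of A.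
    When alpha contains no broken circuit, no atom below x is smaller than the element
    of A in its layer, so every other beta with the same image, up to sign, precedes
    alpha ([nbc_layer_lex]), that is, e_beta is a larger monomial than e_alpha.  The
    coefficient of the product of A in the image of an element g
    of J with leading monomial e_alpha therefore comes from e_alpha alone
    ([nbc_not_leading]); it is nonzero, although g is sent to 0. *)

(** * Finite linear orders and covers *)

Section FiniteOrders.

Lemma linear_order_rev {T : Type} (A : {pred T}) (r : rel T) :
  linear_order_on A r -> linear_order_on A (fun x y => r y x).
Proof.
move=> [tot anti tr]; split=> [x y Ax Ay|x y Ax Ay|y x z Ay Ax Az yx zy].
- exact: tot.
- by rewrite andbC; apply: anti.
- exact: (tr y z x).
Qed.

Lemma linear_order_refl {T : Type} (A : {pred T}) (r : rel T) :
  linear_order_on A r -> {in A, reflexive r}.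
Proof. by move=> [tot _ _] x Ax; have := tot x x Ax Ax; rewrite orbb. Qed.

(** The maximum is the element with the most predecessors in D. *)
Lemma linear_max {T : finType} (A : {pred T}) (r : rel T) (D : {set T}) :
  linear_order_on A r -> {subset D <= A} -> D != set0 ->
  exists2 s, s \in D & {in D, forall u, r u s}.
Proof.
move=> lin sDA /set0Pn[s0 s0D]; have [tot anti tr] := lin.
case: (@arg_maxnP _ s0 (mem D) (fun s => #|[set u in D | r u s]|) s0D) => s /= sD smax.
exists s => // u uD; have /orP[//|su] := tot u s (sDA _ uD) (sDA _ sD).
apply: contraTT (smax u uD) => nus; rewrite /= -ltnNge; apply: proper_card.
apply/properP; split.
  apply/subsetP=> v; rewrite !inE => /andP[vD vs]; rewrite vD /=.
  by apply: (tr s) => //; apply: sDA.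
exists u; rewrite inE uD ?(negPf nus) //=.
by apply: (linear_order_refl lin); apply: sDA.
Qed.

Lemma linear_min {T : finType} (A : {pred T}) (r : rel T) (D : {set T}) :
  linear_order_on A r -> {subset D <= A} -> D != set0 ->
  exists2 s, s \in D & {in D, forall u, r s u}.
Proof. by move=> /linear_order_rev lin; apply: linear_max lin. Qed.

Local Open Scope order_scope.
Context {d : Order.disp_t} {P : finPOrderType d}.

Lemma lower_cover (x y : P) : x < y -> exists2 z, x <= z & covers y z.
Proof.
move=> xy.
have xP : (x <= x) && (x < y) by rewrite lexx.
case: (@arg_maxnP _ x (fun z => (x <= z) && (z < y))
  (fun z => #|[set u | u <= z]|) xP) => z /andP[xz zy] zmax.
exists z => //; rewrite /covers zy; apply/forallP=> v; apply/negP=> /andP[zv vy].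
have /zmax : (x <= v) && (v < y) by rewrite (le_trans xz (ltW zv)).
rewrite /= leqNgt => /negP; apply; apply: proper_card; apply/properP; split.
  by apply/subsetP=> u; rewrite !inE => uz; apply: le_trans uz (ltW zv).
by exists v; rewrite inE // lt_geF.
Qed.

End FiniteOrders.

(** * Joins in a down-set and their rank *)

Section RankFunction.
Local Open Scope order_scope.
Context {d : Order.disp_t} {P : finBPOrderType d} (rho : P -> nat).
Hypothesis rk : rank_function rho.

Lemma rank_lt (x y : P) : x < y -> (rho x < rho y)%N.
Proof.
case: rk => homo _ cov xy; have [z xz zy] := lower_cover xy.
by rewrite (cov _ _ zy) ltnS homo.
Qed.

Lemma rank_le_eq (x y : P) : x <= y -> (rho y <= rho x)%N -> x = y.
Proof.
by rewrite le_eqVlt => /orP[/eqP//|/rank_lt]; rewrite ltnNge => /negPf->.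
Qed.

(** A minimal element is reached by minimizing the rank, which is strictly
    monotone. *)
Lemma exists_minimal_bound (D : {set P}) (v : P) : v \in D ->
  exists z, [/\ z \in D, z <= v & {in D, forall u, u <= z -> u = z}].
Proof.
move=> vD.
have vP : (v \in D) && (v <= v) by rewrite vD lexx.
case: (@arg_minnP _ v (fun z => (z \in D) && (z <= v)) rho vP) => z /andP[zD zv] zmin.
exists z; split=> // u uD uz; apply: rank_le_eq => //.
by apply: zmin; rewrite uD (le_trans uz zv).
Qed.

End RankFunction.

Section LocallyGeometric.
Local Open Scope order_scope.
Context {d : Order.disp_t} {P : finBPOrderType d} (rho : P -> nat).
Hypothesis LG : locally_geometric rho.

Let rk : rank_function rho := LG.1.

Lemma downset_le (x : P) (a b : downset x) : (a <= b) = (val a <= val b).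
Proof. by rewrite -Order.le_val. Qed.

Lemma downset_lt (x : P) (a b : downset x) : (a < b) = (val a < val b).
Proof. by rewrite -lt_val. Qed.

(** The rank function given by the geometric lattice structure of a down-set has to
    be the restriction of [rho], since both grow by one along covers. *)
Lemma downset_rank (x : P) (r : downset x -> nat) :
  rank_function r -> forall y, r y = rho (val y).
Proof.
move=> [_ r0 rcov] y; have [n] := ubnP (rho (val y)); elim: n y => // n IH y.
rewrite ltnS => yn; have [y0|yn0] := eqVneq (val y) \bot.
  have -> : y = \bot by apply: val_inj; rewrite y0.
  by rewrite r0; case: rk.
have [z _ cz] : exists2 z, \bot <= z & covers (val y) z.
  by apply: lower_cover; rewrite lt0x.
have /andP[zy /forallP nz] := cz.
have zx : z <= x by apply: le_trans (ltW zy) (valP y).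
have /rcov -> : covers y (Downset zx).
  rewrite /covers downset_lt /= zy; apply/forallP=> u.
  by have := nz (val u); rewrite !downset_lt.
rewrite IH /=; last by apply: leq_trans yn; apply: (rank_lt rk).
by case: rk => _ _ /(_ _ _ cz)->.
Qed.

(** The binary join of a down-set, described inside P.  The bound on the rank is all
    that semimodularity contributes. *)
Lemma lub2 (x a b : P) : a <= x -> b <= x ->
  exists j, [/\ j <= x, forall v, v <= x -> (j <= v) = (a <= v) && (b <= v)
    & (rho j <= rho a + rho b)%N].
Proof.
move=> ax bx; have [lat [r [rr _ sm]]] := LG.2 x.
have [[j Ej] [m Em]] := lat (Downset ax) (Downset bx).
have jJ : j \in joins [set Downset ax; Downset bx] by rewrite Ej set11.
have ub v (vx : v <= x) :
    (Downset vx \in ubounds [set Downset ax; Downset bx]) = (a <= v) && (b <= v).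
  rewrite inE; apply/forall_inP/andP => [H|[av bv] y].
    by have := (H (Downset ax), H (Downset bx));
      rewrite !inE !eqxx orbT !downset_le => -[-> // ->].
  by rewrite !inE => /orP[]/eqP->; rewrite downset_le.
exists (val j); split; first exact: (valP j).
  move=> v vx; rewrite -(ub v vx); apply/idP/idP => [jv|vU].
    rewrite ub; move: jJ; rewrite inE => /andP[]; case: (j) jv => j0 j0x /= jv.
    by rewrite ub => /andP[aj bj] _; rewrite (le_trans aj jv) (le_trans bj jv).
  have [z [zU zv zmin]] := exists_minimal_bound rr vU.
  have : z \in joins [set Downset ax; Downset bx].
    by rewrite inE zU; apply/forall_inP=> u uU; apply/implyP=> /(zmin _ uU)->.
  by rewrite Ej inE => /eqP<-; move: zv; rewrite downset_le.
have mM : m \in meets [set Downset ax; Downset bx] by rewrite Em set11.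
have := sm _ _ _ _ jJ mM; rewrite !(downset_rank rr) /=.
exact/leq_trans/leq_addr.
Qed.

(** P itself need not have joins, but every set of elements below x has a least upper bound
    among the elements below x; [lub x U] is that bound. *)
Definition is_lub (x : P) (U : {set P}) (j : P) : bool :=
  (j <= x) && [forall v, (v <= x) ==> ((j <= v) == (v \in ubounds U))].

Definition lub (x : P) (U : {set P}) : P := odflt \bot [pick j | is_lub x U j].

Lemma lub_spec (x : P) (U : {set P}) : x \in ubounds U ->
  lub x U <= x /\ forall v, v <= x -> (lub x U <= v) = (v \in ubounds U).
Proof.
move=> xU; rewrite /lub; case: pickP => /= [j /andP[jx /forallP jP]|].
  by split=> // v vx; have := jP v; rewrite vx => /eqP.
suff [j jl] : exists j, is_lub x U j by move/(_ j); rewrite jl.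
have [n] := ubnP #|U|; elim: n U xU => // n IH U xU; rewrite ltnS => Un.
have [->|/set0Pn[t tU]] := eqVneq U set0.
  exists \bot; rewrite /is_lub le0x; apply/forallP=> v; apply/implyP=> _.
  by rewrite le0x inE eq_sym eqb_id; apply/forall_inP=> y; rewrite inE.
have xs : x \in ubounds (U :\ t).
  move: xU; rewrite !inE => /forall_inP xU; apply/forall_inP=> y /setD1P[_].
  exact: xU.
have tx : t <= x by move: xU; rewrite inE => /forall_inP; apply.
have [|i /andP[ix /forallP iP]] := IH _ xs.
  by rewrite (cardsD1 t U) tU in Un.
have [j [jx jP _]] := lub2 tx ix; exists j; rewrite /is_lub jx.
apply/forallP=> v; apply/implyP=> vx; rewrite jP //.
have := iP v; rewrite vx => /eqP->; rewrite !inE; apply/eqP.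
apply/andP/forall_inP => [[tv /forall_inP H] y yU|H].
  by have [->//|yt] := eqVneq y t; apply: H; rewrite !inE yt.
by split; [exact: H | apply/forall_inP=> y /setD1P[_]; apply: H].
Qed.

Section Below.
Variable x : P.
Local Notation below U := (x \in ubounds U).

Lemma lub_le U : below U -> lub x U <= x.
Proof. by move/lub_spec=> []. Qed.

Lemma le_lub U t : below U -> t \in U -> t <= lub x U.
Proof.
move=> bU tU; have [lx lP] := lub_spec bU.
by have := lP _ lx; rewrite lexx inE => /esym/forall_inP; apply.
Qed.

Lemma lub_least U v : below U -> v <= x -> {in U, forall t, t <= v} -> lub x U <= v.
Proof.
by move=> bU vx H; rewrite (lub_spec bU).2 // inE; apply/forall_inP.
Qed.

Lemma belowS (U V : {set P}) : U \subset V -> below V -> below U.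
Proof.
move=> /subsetP UV; rewrite !inE => /forall_inP xV; apply/forall_inP=> y /UV.
exact: xV.
Qed.

Lemma belowU1 t (U : {set P}) : below (t |: U) = (t <= x) && below U.
Proof.
rewrite !inE; apply/forall_inP/andP=> [H|[tx /forall_inP H] y /setU1P[->//|/H//]].
by split; [apply: H; rewrite setU11 | apply/forall_inP=> y yU; apply: H; rewrite setU1r].
Qed.

Lemma lubS (U V : {set P}) : U \subset V -> below V -> lub x U <= lub x V.
Proof.
move=> UV bV; apply: lub_least (belowS UV bV) (lub_le bV) _ => t tU.
by apply: le_lub bV _; apply: (subsetP UV).
Qed.

Lemma lub_join U : below U -> lub x U \in joins U.
Proof.
move=> bU; rewrite inE (_ : _ \in ubounds U).
  apply/forall_inP=> z zU; apply/implyP=> zl; rewrite eq_le zl.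
  by rewrite (lub_spec bU).2 // (le_trans zl (lub_le bU)).
by rewrite -(lub_spec bU).2 ?lub_le.
Qed.

Lemma join_lub U j : j \in joins U -> j <= x -> j = lub x U.
Proof.
move=> + jx; rewrite inE => /andP[jU /forall_inP jmin].
have bU : below U.
  move: jU; rewrite !inE => /forall_inP H; apply/forall_inP=> y /H yj.
  exact: le_trans yj jx.
apply/esym/eqP; apply: (implyP (jmin (lub x U) _)).
  by rewrite -(lub_spec bU).2 ?lub_le.
by rewrite (lub_spec bU).2.
Qed.

(** Joining one more atom raises the rank by at most one: semimodularity for the join
    of an atom and an arbitrary element. *)
Lemma rank_lubU1 t U : t \in atoms rho -> below (t |: U) ->
  (rho (lub x (t |: U)) <= (rho (lub x U)).+1)%N.
Proof.
move=> tat btU; have := btU; rewrite belowU1 => /andP[tx bU].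
have [j [jx jP jr]] := lub2 tx (lub_le bU).
move: tat jr; rewrite inE => /eqP->; rewrite add1n; apply: leq_trans.
case: rk => homo _ _; apply: homo; apply: lub_least => // u.
have := jP _ jx; rewrite lexx => /esym/andP[tj lj].
by move/setU1P=> [->//|uU]; apply: le_trans lj; apply: le_lub.
Qed.

Lemma rank_lubU (U V : {set P}) : V \subset atoms rho -> below (U :|: V) ->
  (rho (lub x (U :|: V)) <= rho (lub x U) + #|V|)%N.
Proof.
have [n] := ubnP #|V|; elim: n V => // n IH V; rewrite ltnS => Vn Vat bUV.
have [->|/set0Pn[t tV]] := eqVneq V set0; first by rewrite setU0 cards0 addn0.
have cV := cardsD1 t V; rewrite tV add1n in cV.
have E : U :|: V = t |: (U :|: (V :\ t)) by rewrite setUCA setD1K.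
have sV : V :\ t \subset V by apply: subsetDl.
rewrite E (leq_trans (rank_lubU1 _ _)) -?E ?(subsetP Vat) //.
rewrite cV addnS ltnS IH -?cV //; first exact: subset_trans Vat.
exact: belowS (setUS _ sV) bUV.
Qed.

Lemma lub0 : lub x set0 = \bot.
Proof.
apply/eqP; rewrite -lex0; apply: lub_least; rewrite ?le0x //.
  by rewrite inE; apply/forall_inP=> y; rewrite inE.
by move=> t; rewrite inE.
Qed.

Lemma rank_lub_card (V : {set P}) : V \subset atoms rho -> below V ->
  (rho (lub x V) <= #|V|)%N.
Proof.
move=> Vat bV; have := @rank_lubU set0 V Vat; rewrite set0U lub0.
by case: rk => _ -> _; apply.
Qed.

(** The independent sets of the matroid on the atoms below x. *)
Definition indep_set (U : {set P}) := rho (lub x U) == #|U|.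

Lemma indep_setS (U V : {set P}) : U \subset V -> V \subset atoms rho -> below V ->
  indep_set V -> indep_set U.
Proof.
move=> UV Vat bV fV; rewrite /indep_set eqn_leq rank_lub_card /=; last 2 first.
- exact: subset_trans UV Vat.
- exact: belowS UV bV.
have EV : U :|: (V :\: U) = V by rewrite setDE setUIr setUCr setIT; apply/setUidPr.
have := @rank_lubU U (V :\: U) (subset_trans (subsetDl _ _) Vat).
rewrite EV (eqP fV) => /(_ bV); rewrite cardsD (setIidPr UV).
by rewrite -[X in (X <= _)%N](subnKC (subset_leq_card UV)) leq_add2r.
Qed.

Lemma lub_closed (U : {set P}) t : below (t |: U) -> t <= lub x U ->
  lub x (t |: U) = lub x U.
Proof.
move=> btU tl; have := btU; rewrite belowU1 => /andP[_ bU].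
apply: le_anti; rewrite (lubS (subsetUr [set t] U)) // andbT; apply: lub_least => //.
  exact: lub_le.
by move=> u /setU1P[->//|]; apply: le_lub.
Qed.

(** Adding a spanned atom keeps the join while the cardinality grows. *)
Lemma spanned_not_indep_set (U : {set P}) t : U \subset atoms rho -> below U ->
  t \notin U -> t <= lub x U -> ~~ indep_set (t |: U).
Proof.
move=> Uat bU tU tl; rewrite /indep_set lub_closed // ?cardsU1 ?tU.
  by rewrite neq_ltn ltnS rank_lub_card.
by rewrite belowU1 bU (le_trans tl (lub_le bU)).
Qed.

Lemma indep_set_grow (U : {set P}) t : U \subset atoms rho -> below (t |: U) ->
  t \in atoms rho -> indep_set U -> ~~ (t <= lub x U) -> indep_set (t |: U).
Proof.
move=> Uat btU tat /eqP fU ntl; have := btU; rewrite belowU1 => /andP[_ bU].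
have tU : t \notin U by apply: contra ntl; apply: le_lub.
rewrite /indep_set eqn_leq cardsU1 tU add1n -fU rank_lubU1 //=.
apply: (rank_lt rk); rewrite lt_neqAle lubS ?subsetUr // andbT.
by apply: contra ntl => /eqP->; apply: le_lub; rewrite ?setU11.
Qed.

End Below.

(** * The simplicial poset and its circuits *)

Local Notation S := (simp rho).

Lemma at_atoms (a : S) : at_of a \subset atoms rho.
Proof. by have /andP[] := valP a. Qed.

Lemma top_join (a : S) : top_of a \in joins (at_of a).
Proof. by have /andP[] := valP a. Qed.

Lemma below_at (a : S) x : top_of a <= x -> x \in ubounds (at_of a).
Proof.
move=> ax; have := top_join a; rewrite !inE => /andP[/forall_inP H _].
by apply/forall_inP=> y /H ya; apply: le_trans ax.
Qed.

Lemma top_lub (a : S) x : top_of a <= x -> top_of a = lub x (at_of a).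
Proof. exact: join_lub (top_join a). Qed.

(** Below x an element of the simplicial poset amounts to a set of atoms: its first
    component is forced to be the join in the down-set of x. *)
Lemma simp_of x (U : {set P}) : U \subset atoms rho -> x \in ubounds U ->
  exists2 a : S, at_of a = U & top_of a = lub x U.
Proof.
move=> Uat bU.
have H : ((lub x U, U).2 \subset atoms rho) && ((lub x U, U).1 \in joins (lub x U, U).2).
  by rewrite /= Uat lub_join.
by exists (Simp H).
Qed.

Lemma indepE (a : S) x : top_of a <= x -> indep a = indep_set x (at_of a).
Proof. by move=> ax; rewrite /indep (top_lub ax). Qed.

Lemma leSE (a b : S) : (a <= b) = (top_of a <= top_of b) && (at_of a \subset at_of b).
Proof. by []. Qed.

Lemma le_simpE (a b : S) x : top_of a <= x -> top_of b <= x ->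
  (a <= b) = (at_of a \subset at_of b).
Proof.
move=> ax bx; rewrite leSE andb_idl // => sab.
by rewrite (top_lub ax) (top_lub bx) lubS // below_at.
Qed.

Lemma simp_inj (a b : S) x : top_of a <= x -> top_of b <= x ->
  at_of a = at_of b -> a = b.
Proof. by move=> ax bx e; apply: le_anti; rewrite !(@le_simpE _ _ x) // e subxx. Qed.

Lemma top_le (a b : S) : a <= b -> top_of a <= top_of b.
Proof. by rewrite leSE => /andP[]. Qed.

Lemma at_le (a b : S) : a <= b -> at_of a \subset at_of b.
Proof. by rewrite leSE => /andP[]. Qed.

Lemma at_set0 (a : S) : (at_of a == set0) = (a == \bot).
Proof.
apply/eqP/eqP => [a0|->//]; apply: (@simp_inj _ _ (top_of a)) => //.
exact: le0x.
Qed.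

Lemma indepS (a b : S) : a <= b -> indep b -> indep a.
Proof.
move=> ab; rewrite (indepE (top_le ab)) (indepE (lexx _)) => fb.
by apply: indep_setS fb; rewrite ?at_le ?at_atoms ?below_at.
Qed.

Lemma delP (a : S) t : del a t <= a /\ at_of (del a t) = at_of a :\ t.
Proof.
rewrite /del; case: pickP => [b /andP[ba /eqP eb]|] //=.
have sat := subsetDl (at_of a) [set t].
have bU := belowS sat (below_at (lexx (top_of a))).
have [b eb tb] := simp_of (subset_trans sat (at_atoms a)) bU.
by move/(_ b); rewrite leSE tb eb eqxx sat (lub_le bU).
Qed.

Lemma delE (a b : S) t : b <= a -> at_of b = at_of a :\ t -> del a t = b.
Proof.
move=> ba eb; have [da ed] := delP a t.
by apply: (@simp_inj _ _ (top_of a)); rewrite ?top_le // ed.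
Qed.

Lemma exists_circuit (a : S) : ~~ indep a -> exists2 z, circuit z & z <= a.
Proof.
move=> na; have aP : ~~ indep a && (a <= a) by rewrite na lexx.
case: (@arg_minnP _ a (fun z => ~~ indep z && (z <= a)) (fun z => #|at_of z|) aP).
move=> z /andP[nz za] zmin; exists z => //; rewrite /circuit nz.
apply/forall_inP=> y ny; apply/implyP=> yz; apply/eqP.
apply: (@simp_inj _ _ (top_of z)); rewrite ?top_le //; apply/eqP.
by rewrite eqEcard at_le // zmin // ny (le_trans yz za).
Qed.

Lemma circuit_dep (z : S) : circuit z -> ~~ indep z.
Proof. by case/andP. Qed.

Lemma circuit_del_indep (z : S) t : circuit z -> t \in at_of z -> indep (del z t).
Proof.
move=> /andP[_ /forallP zmin] tz; have [dz ed] := delP z t.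
apply: contraTT (tz) => nd; have := zmin (del z t); rewrite nd dz /= => /eqP e.
by rewrite -e ed setD11.
Qed.

(** The deletion is independent, so its rank is the size of z minus one; as z is
    dependent, its own rank is no larger. *)
Lemma circuit_del_top (z : S) t : circuit z -> t \in at_of z ->
  top_of (del z t) = top_of z.
Proof.
move=> cz tz; have [dz ed] := delP z t.
apply: (rank_le_eq rk (top_le dz)); have := circuit_del_indep cz tz.
rewrite /indep ed => /eqP->; have := circuit_dep cz.
have := rank_lub_card (at_atoms z) (below_at (lexx _)).
rewrite -top_lub // /indep (cardsD1 t (at_of z)) tz add1n leq_eqVlt => /orP[/eqP->|//].
by rewrite eqxx.
Qed.

(** The atom t lies below the join of the rest of the circuit, hence below the join
    of the rest of w. *)
Lemma circuit_del_top_above (w z : S) t : circuit z -> z <= w -> t \in at_of z ->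
  top_of (del w t) = top_of w.
Proof.
move=> cz zw tz; have [dw ed] := delP w t; have [dz edz] := delP z t.
apply: le_anti; rewrite top_le //= {1}(top_lub (lexx (top_of w))).
apply: lub_least; rewrite ?below_at ?top_le // => u uw.
have [->|ut] := eqVneq u t; last first.
  have := below_at (lexx (top_of (del w t))); rewrite inE => /forall_inP; apply.
  by rewrite ed !inE ut.
have dzdw : del z t <= del w t.
  rewrite (@le_simpE _ _ (top_of w)) ?ed ?edz ?setSD ?at_le ?top_le //.
  exact: le_trans zw.
apply: le_trans (top_le dzdw); rewrite circuit_del_top //.
by have := below_at (lexx (top_of z)); rewrite inE => /forall_inP; apply.
Qed.

(** An atom has rank one, so the bottom and the one-atom elements are independent. *)
Lemma circuit_card (z : S) : circuit z -> (1 < #|at_of z|)%N.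
Proof.
move=> cz; have nz := circuit_dep cz; rewrite ltnNge leq_eqVlt ltnS leqn0.
apply: contra nz => /orP[/cards1P[t et]|].
  have ta : t \in atoms rho by have := at_atoms z; rewrite et sub1set.
  rewrite /indep et cards1; move: ta; rewrite inE; congr (rho _ == _).
  have := top_join z; rewrite et inE => /andP[zub /forall_inP zm].
  have /implyP : (t <= top_of z) ==> (t == top_of z).
    by apply: zm; rewrite inE; apply/forall_inP=> y /set1P->.
  move=> H; apply/eqP; apply: H; move: zub; rewrite inE => /forall_inP; apply.
  by rewrite set11.
by rewrite cards_eq0 at_set0 => /eqP->; rewrite /indep cards0; case: rk => _ ->.
Qed.

(** If y is a second circuit below w and t is in z but not in y, then removing t
    keeps the join of w, so what remains is independent although it contains y. *)
Lemma unicircular_of_nullity1 (w z : S) : circuit z -> z <= w ->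
  (rho (top_of w)).+1 = #|at_of w| -> unicircular z w.
Proof.
move=> cz zw rw; rewrite /unicircular cz zw; apply/forall_inP=> y cy.
apply/implyP=> yw.
have [szy|/subsetPn[t tz ty]] := boolP (at_of z \subset at_of y).
  have /andP[_ /forall_inP/(_ z (circuit_dep cz))] := cy.
  by rewrite (@le_simpE _ _ (top_of w)) ?top_le // szy eq_sym.
have [dw ed] := delP w t.
have tw : t \in at_of w by apply: (subsetP (at_le zw)).
have id : indep (del w t).
  rewrite /indep (circuit_del_top_above cz) // ed -eqSS rw.
  by rewrite (cardsD1 t (at_of w)) tw.
have /negP[] := circuit_dep cy; apply: indepS id.
rewrite (@le_simpE _ _ (top_of w)) ?top_le // ed; apply/subsetP=> u uy.
by rewrite !inE (subsetP (at_le yw)) // andbT; apply: contraNneq ty => <-.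
Qed.

Lemma unicircular_del_indep (w z : S) t : unicircular z w -> t \in at_of z ->
  indep (del w t).
Proof.
move=> /and3P[_ _ /forall_inP uz] tz; have [dw ed] := delP w t.
apply: contraTT (tz) => /exists_circuit[y cy yd].
have := uz y cy; rewrite (le_trans yd dw) => /eqP <-.
by apply/negP=> /(subsetP (at_le yd)); rewrite ed setD11.
Qed.

(** A common atom t gives the common lower bound (t, {t}). *)
Lemma meets_bot (a b : S) :
  (meets [set a; b] == [set \bot]) = [disjoint at_of a & at_of b].
Proof.
have lbP (l : S) : (l \in lbounds [set a; b]) = (l <= a) && (l <= b).
  rewrite inE; apply/forall_inP/andP => [H|[la lb] y /set2P[]->//].
  by split; apply: H; rewrite !inE eqxx ?orbT.
have [dab|/pred0Pn[t /= /andP[ta tb]]] := boolP [disjoint _ & _].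
  have lb0 l : l \in lbounds [set a; b] -> l = \bot.
    rewrite lbP => /andP[/at_le la /at_le lb]; apply/eqP; rewrite -at_set0.
    by rewrite -subset0 -(disjoint_setI0 dab) subsetI la lb.
  apply/eqP/setP=> l; rewrite !inE -/(l \in lbounds _); apply/andP/eqP.
    by case=> /forall_inP H _; apply: lb0; rewrite inE; apply/forall_inP.
  move=> ->; split; first by apply/forall_inP=> y _; apply: le0x.
  by apply/forall_inP=> z /lb0->; rewrite eqxx implybT.
apply/negbTE/eqP=> E.
have tx (c : S) : t \in at_of c -> t <= top_of c.
  have := below_at (lexx (top_of c)); rewrite inE => /forall_inP; apply.
have tat : [set t] \subset atoms rho by rewrite sub1set (subsetP (at_atoms a)).
have tbU : t \in ubounds [set t] by rewrite inE; apply/forall_inP=> y /set1P->.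
have [c ec tc] := simp_of tat tbU.
have ct : top_of c <= t by rewrite tc lub_le.
have : \bot \in meets [set a; b] by rewrite E set11.
rewrite inE => /andP[_ /forall_inP/(_ c)]; rewrite le0x lbP !leSE ec !sub1set ta tb.
rewrite !(le_trans ct (tx _ _)) // => /(_ isT)/eqP c0.
by have := at_set0 c; rewrite c0 eqxx -c0 ec => /eqP/setP/(_ t); rewrite !inE eqxx.
Qed.

Lemma joins_at (a b c : S) : c \in joins [set a; b] ->
  [/\ a <= c, b <= c & at_of c = at_of a :|: at_of b].
Proof.
rewrite inE => /andP[]; rewrite inE => /forall_inP cub /forall_inP cmin.
have ac : a <= c by apply: cub; rewrite !inE eqxx.
have bc : b <= c by apply: cub; rewrite !inE eqxx orbT.
split=> //; have sc : at_of a :|: at_of b \subset at_of c.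
  by rewrite subUset !at_le.
have bl := below_at (lexx (top_of c)).
have [e ee te] := simp_of (subset_trans sc (at_atoms c)) (belowS sc bl).
have et : top_of e <= top_of c by rewrite te lub_le // (belowS sc).
have /implyP : (e <= c) ==> (e == c).
  apply: cmin; rewrite inE; apply/forall_inP=> y /set2P[]->;
    by rewrite (@le_simpE _ _ (top_of c)) ?(top_le ac) ?(top_le bc) // ee
      ?subsetUl ?subsetUr.
by rewrite (@le_simpE _ _ (top_of c)) // ee sc => /(_ isT)/eqP <-.
Qed.

(** The joins of a and b all have the atom set of a together with that of b, so they
    differ by their first component, which is determined below x. *)
Lemma joins_below (a b : S) x : top_of a <= x -> top_of b <= x ->
  exists c, [/\ c \in joins [set a; b], top_of c <= x
    & forall c', c' \in joins [set a; b] -> top_of c' <= x -> c' = c].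
Proof.
move=> ax bx.
have bU : x \in ubounds (at_of a :|: at_of b).
  rewrite inE; apply/forall_inP=> y /setUP[] yab;
   [have := below_at ax | have := below_at bx]; by rewrite inE => /forall_inP; apply.
have Uat : at_of a :|: at_of b \subset atoms rho by rewrite subUset !at_atoms.
have [c ec tc] := simp_of Uat bU.
have cx : top_of c <= x by rewrite tc lub_le.
exists c; split=> //; last first.
  move=> c' /joins_at[_ _ e'] c'x; apply: (simp_inj c'x cx).
  by rewrite e' ec.
rewrite inE; apply/andP; split.
  rewrite inE; apply/forall_inP=> y /set2P[]->;
    by rewrite (@le_simpE _ _ x) // ec ?subsetUl ?subsetUr.
apply/forall_inP=> z; rewrite inE => /forall_inP zub; apply/implyP=> zc.
have az : a <= z by apply: zub; rewrite !inE eqxx.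
have bz : b <= z by apply: zub; rewrite !inE eqxx orbT.
rewrite (@simp_inj z c x) //; first exact: le_trans (top_le zc) cx.
by apply/eqP; rewrite eqEsubset at_le // ec subUset !at_le.
Qed.

End LocallyGeometric.

(** * The flag of an independent set *)

Section BrokenCircuits.
Local Open Scope order_scope.
Context {d : Order.disp_t} {P : finBPOrderType d} (rho : P -> nat).
Hypothesis LG : locally_geometric rho.
Variable lea : rel P.
Hypothesis lin : linear_order_on (mem (atoms rho)) lea.
Variable a : simp rho.
Hypothesis ia : indep a.

Local Notation x := (top_of a).
Local Notation A := (at_of a).
Let tot : {in atoms rho &, total lea}. Proof. by case: lin. Qed.
Let anti : {in atoms rho &, antisymmetric lea}. Proof. by case: lin. Qed.
Let tr : {in atoms rho & &, transitive lea}. Proof. by case: lin. Qed.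
Let refl : {in atoms rho, reflexive lea}. Proof. exact: linear_order_refl lin. Qed.
Let Aat s : s \in A -> s \in atoms rho. Proof. exact/subsetP/at_atoms. Qed.
Let bA : x \in ubounds A. Proof. exact: below_at. Qed.

Definition tail (s : P) : {set P} := [set u in A | lea s u].

(** The joins of the tails [tail s], as s runs through A, form a flag that decreases
    when s grows.  [in_tail_span t s] says that t lies below the member at s. *)
Definition in_tail_span (t s : P) : bool := (s \in A) && (t <= lub x (tail s)).

(** The element of A at which the flag, followed downwards, last contains t. *)
Definition layer (t : P) : P :=
  odflt t [pick s | in_tail_span t s && [forall s', in_tail_span t s' ==> lea s' s]].

(** A contains no broken circuit: an atom below the join of some elements of A is at
    least as large as the smallest of them.  This is stated for the tails of A only,
    to which any other subset can be enlarged. *)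
Definition nbc : Prop :=
  {in atoms rho, forall t s, t <= x -> in_tail_span t s -> lea s t}.

Let tail_sub s : tail s \subset A.
Proof. by apply/subsetP=> u; rewrite inE => /andP[]. Qed.

Let tail_below s : x \in ubounds (tail s).
Proof. exact: belowS bA. Qed.

Let atx t : t \in A -> t <= x.
Proof. by move=> tA; move: bA; rewrite inE => /forall_inP; apply. Qed.

Let fA : indep_set rho x A.
Proof. by rewrite -indepE. Qed.

(** The converse of [le_lub] for subsets of A, by independence of A. *)
Lemma span_mem (V : {set P}) t : V \subset A -> t \in A -> t <= lub x V -> t \in V.
Proof.
move=> VA tA tl; apply: contraTT (fA) => tV.
have tVA : t |: V \subset A by rewrite subUset sub1set tA.
have := spanned_not_indep_set LG (subset_trans VA (at_atoms a)) (belowS VA bA) tV tl.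
by apply: contra; apply: indep_setS; rewrite ?at_atoms.
Qed.

(** Some member of the flag contains t since the tail at the smallest element of A is
    A, whose join is x.  A is nonempty as x lies above an atom. *)
Lemma layerP t : t \in atoms rho -> t <= x ->
  in_tail_span t (layer t) /\ forall s, in_tail_span t s -> lea s (layer t).
Proof.
move=> tat tx; rewrite /layer; case: pickP => /= [s /andP[cs /forall_inP cm]|] //.
have A0 : A != set0.
  apply: contraTneq tat => A0; have : x = \bot.
    by rewrite -(lub0 LG x) -A0; apply: top_lub.
  move=> x0; have : t = \bot by apply/eqP; rewrite -lex0 -x0.
  by move=> ->; rewrite inE; case: LG => -[_ -> _].
have [s0 s0A s0min] := linear_min lin Aat A0.
have as0 : tail s0 = A by apply/setP=> u; rewrite inE andb_idr // => /s0min.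
have [||s sD smax] := @linear_max _ _ _ [set s | in_tail_span t s] lin.
- by move=> s; rewrite inE => /andP[/Aat].
- apply/set0Pn; exists s0; rewrite inE /in_tail_span s0A as0 /=.
  by rewrite -(top_lub LG (lexx _)).
move/(_ s); rewrite inE in sD; rewrite sD => /negP[]; apply/forall_inP=> u cu.
by apply: smax; rewrite inE.
Qed.

Lemma layer_mem t : t \in atoms rho -> t <= x -> layer t \in A.
Proof. by move=> tat tx; have [/andP[]] := layerP tat tx. Qed.

Lemma layer_id s : s \in A -> layer s = s.
Proof.
move=> sA; have [/andP[cA cl] cm] := layerP (Aat sA) (atx sA).
apply: anti; rewrite ?Aat //; have /= := span_mem (tail_sub _) sA cl.
rewrite inE => /andP[_ ->] /=; apply: cm; rewrite /in_tail_span sA.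
by apply: (le_lub LG (tail_below _)); rewrite inE sA refl ?Aat.
Qed.

(** Let t be the element of U with the smallest layer.  The others lie below a later
    member of the flag, which does not contain t, so t can be added to them without
    losing independence. *)
Lemma layer_inj_indep_set (U : {set P}) : U \subset atoms rho -> x \in ubounds U ->
  {in U &, injective layer} -> indep_set rho x U.
Proof.
have [n] := ubnP #|U|; elim: n U => // n IH U; rewrite ltnS => Un Uat bU inj.
have [->|U0] := eqVneq U set0.
  by rewrite /indep_set (lub0 LG) cards0; case: LG => -[_ ->].
have Ux t : t \in U -> t <= x by move=> tU; move: bU; rewrite inE => /forall_inP; apply.
have Um t : t \in U -> t \in atoms rho by apply: (subsetP Uat).
have cA t : t \in U -> layer t \in A by move=> tU; rewrite layer_mem ?Um ?Ux.
have [||_ /imsetP[t tU ->] tmin] := @linear_min _ _ _ (layer @: U) lin.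
- by move=> s /imsetP[t tU ->]; apply/Aat/cA.
- by rewrite imset_eq0.
have sU := subsetDl U [set t].
have fU : indep_set rho x (U :\ t).
  apply: IH; rewrite ?(subset_trans sU) ?(belowS sU) //.
    by rewrite (cardsD1 t U) tU in Un.
  by move=> u v /(subsetP sU) uU /(subsetP sU) vU; apply: inj.
rewrite -(setD1K tU); apply: indep_set_grow => //; rewrite ?setD1K ?Um //.
  exact: subset_trans Uat.
(* If t were below the join of the others, it would be below the member of the flag
   at the smallest of their layers, which is strictly larger than the layer of t. *)
apply/negP=> tl; have [U'0|U'0] := eqVneq (U :\ t) set0.
  have : t \in atoms rho by apply: Um.
  move: tl; rewrite U'0 (lub0 LG) lex0 => /eqP->; rewrite inE.
  by case: LG => -[_ -> _].
have [||_ /imsetP[t' /setD1P[t't t'U] ->] smin] := @linear_min _ _ _ (layer @: (U :\ t)) lin.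
- by move=> s /imsetP[v /(subsetP sU) vU ->]; apply/Aat/cA.
- by rewrite imset_eq0.
case/eqP: t't; apply: inj => //; apply: anti; rewrite ?Aat ?cA //.
rewrite tmin ?imset_f // andbT.
have [_] := layerP (Um _ tU) (Ux _ tU); apply; rewrite /in_tail_span cA //.
apply: le_trans tl _; apply: (lub_least LG) => //; first exact: belowS bU.
  exact: (lub_le LG (tail_below _)).
move=> v vU'; have vU := subsetP sU v vU'.
have [/andP[_ vl] _] := layerP (Um _ vU) (Ux _ vU).
apply: le_trans vl _; apply: (lubS LG _ (tail_below _)); apply/subsetP=> w.
rewrite !inE => /andP[wA]; rewrite wA; apply: tr; rewrite ?Aat ?cA //.
by apply: smin; apply: imset_f.
Qed.

Lemma nbc_layer_le t : nbc -> t \in atoms rho -> t <= x -> lea (layer t) t.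
Proof. by move=> n tat tx; apply: n => //; have [] := layerP tat tx. Qed.

(** The element w is (x, A + t), and z is a circuit inside t and the tail at s, whose
    elements are all larger than t. *)
Lemma broken_circuit_unicircular t s : t \in atoms rho -> t <= x ->
  in_tail_span t s -> ~~ lea s t ->
  exists w z, [/\ unicircular z w, t \in at_of z, del w t = a
    & {in at_of z, forall u, lea t u}].
Proof.
move=> tat tx /andP[sA tl] nst.
have lts u : lea s u -> u \in atoms rho -> lea t u.
  move=> su uat; have := tot tat (Aat sA); rewrite (negPf nst) orbF => ts.
  exact: (tr (Aat sA) tat uat ts su).
have tA : t \notin A.
  apply: contra nst => tA; have := span_mem (tail_sub s) tA tl.
  by rewrite inE => /andP[].
have btA : x \in ubounds (t |: A) by rewrite belowU1 tx bA.
have tAat : t |: A \subset atoms rho by rewrite subUset sub1set tat at_atoms.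
have ltA : lub x (t |: A) = x.
  rewrite (lub_closed LG) //; first by rewrite -(top_lub LG (lexx _)).
  by rewrite -(top_lub LG (lexx _)).
have [w ew tw] := simp_of LG tAat btA.
have sub : t |: tail s \subset t |: A by apply: setUS.
have [y ey ty] := simp_of LG (subset_trans sub tAat) (belowS sub btA).
have yx : top_of y <= x by rewrite ty (lub_le LG) // (belowS sub).
have wx : top_of w <= x by rewrite tw ltA.
have [z cz zy] : exists2 z : simp rho, circuit z & z <= y.
  apply: exists_circuit => //; rewrite (indepE LG yx) ey.
  apply: (spanned_not_indep_set LG) tl => //.
    exact: subset_trans (tail_sub s) (at_atoms a).
  by apply: contra tA; apply: (subsetP (tail_sub s)).
have zw : z <= w by apply: le_trans zy _; rewrite (le_simpE LG yx wx) ey ew.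
have aw : a <= w by rewrite (le_simpE LG (lexx _) wx) ew subsetUr.
exists w, z; split.
- apply: unicircular_of_nullity1 => //; rewrite tw ltA ew cardsU1 tA.
  by move: ia; rewrite /indep => /eqP->.
- apply: contraT => tz; have /negP[] := circuit_dep cz; apply: indepS ia => //.
  rewrite (le_simpE LG (le_trans (top_le zw) wx)) //; apply/subsetP=> u uz.
  have := subsetP (at_le zw) u uz; rewrite ew in_setU1.
  by case: eqP => // ut; rewrite -ut uz in tz.
- apply: delE => //; rewrite ew; apply/setP=> u; rewrite !inE.
  by case: eqP => // ->; rewrite (negPf tA).
- move=> u uz; have := subsetP (at_le zy) u uz; rewrite ey in_setU1.
  case: eqP => [->|_ /=]; first by rewrite refl.
  by rewrite inE => /andP[uA su]; rewrite lts ?Aat.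
Qed.

(** This is the lexicographic comparison of the order on independent elements: it
    makes b precede a.  Let m be the smallest atom of the symmetric difference and
    suppose that it is in b.  Its layer s, an element of A, is smaller than m, so it
    is not in the symmetric difference; it is then an element of b with the same layer
    as m, against injectivity. *)
Lemma nbc_layer_lex (b : simp rho) : nbc -> indep b -> #|at_of b| = #|A| ->
  top_of b <= x -> {in at_of b &, injective layer} -> b != a ->
  exists2 s, s \in A :\: at_of b &
    forall y, y \in (at_of b :\: A) :|: (A :\: at_of b) -> lea s y.
Proof.
move=> na ib cb bx inj ba.
have batx t : t \in at_of b -> t \in atoms rho /\ t <= x.
  move=> tb; split; first exact: (subsetP (at_atoms b)).
  by have := below_at bx; rewrite inE => /forall_inP; apply.
have tb : top_of b = x.
  by apply: (rank_le_eq LG.1 bx); move: ia ib; rewrite /indep => /eqP-> /eqP->; rewrite cb.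
have [||m mD mmin] := @linear_min _ _ _ ((at_of b :\: A) :|: (A :\: at_of b)) lin.
- move=> u; rewrite in_setU !in_setD => /orP[] /andP[_ uu]; last exact: Aat.
  by have [] := batx u uu.
- apply: contra ba => /eqP D0; apply/eqP; apply: (simp_inj LG bx (lexx _)).
  apply/eqP; rewrite eqEsubset -!setD_eq0 -!subset0 -D0 subsetUl subsetUr.
  by [].
exists m => //; move: mD; rewrite in_setU => /orP[mbA|//].
have /setDP[mb mA] := mbA; have [mat mx] := batx m mb.
have sA := layer_mem mat mx; have sm := nbc_layer_le na mat mx.
have [sb|sb] := boolP (layer m \in at_of b).
  by move: mA; rewrite -(inj _ _ sb mb) ?sA // layer_id.
move: mA; rewrite -(anti (Aat sA) mat) ?sA // sm mmin //.
by rewrite !inE sA sb orbT.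
Qed.

End BrokenCircuits.

(** * Products of anticommuting elements *)

Local Open Scope ring_scope.

Section AnticommutingProducts.
Variable R : nzRingType.

(** Moving the factor of index j to the front passes it over j factors. *)
Lemma prod_lift n (y : 'I_n.+1 -> R) (j : 'I_n.+1) :
  (forall i k, y i * y k = - (y k * y i)) ->
  \prod_i y i = (-1) ^+ j * (y j * \prod_i y (lift j i)).
Proof.
elim: n y j => [|n IH] y j hy.
  by rewrite [j]ord1 !big_ord_recl /= !big_ord0 expr0 mul1r.
case: (unliftP ord0 j) => [j' ->|->]; last by rewrite big_ord_recl expr0 mul1r.
rewrite big_ord_recl (IH _ j') //; rewrite [in RHS]big_ord_recl.
have -> : lift (lift ord0 j') ord0 = ord0 by apply: val_inj.
have -> : \prod_(i < n) y (lift (lift ord0 j') (lift ord0 i)) =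
          \prod_(i < n) y (lift ord0 (lift j' i)).
  by apply: eq_bigr => i _; congr y; apply: val_inj; rewrite /= /bump /= ltnS addnCA.
rewrite lift0 exprS mulN1r mulNr [y (lift _ _) * (_ * _)]mulrA (hy _ ord0).
rewrite mulNr mulrN opprK -[y ord0 * y _ * _]mulrA.
by rewrite [LHS]mulrA commr_sign -mulrA.
Qed.

(** Removing the index 0 and its image turns a permutation into one of a smaller
    set; this drives the induction in [prod_perm]. *)
Lemma lift_permE n (s : 'S_n.+1) : exists s' : 'S_n, s = lift_perm ord0 (s ord0) s'.
Proof.
pose f i := odflt i (unlift (s ord0) (s (lift ord0 i))).
have fE i : lift (s ord0) (f i) = s (lift ord0 i).
  rewrite /f; case: unliftP => [j ->//|/perm_inj/eqP].
  by rewrite eq_sym (negPf (neq_lift _ _)).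
have fI : injective f.
  by move=> i j e; apply: (@lift_inj _ ord0); apply: (@perm_inj _ s); rewrite -!fE e.
exists (perm fI); apply/permP=> i; case: (unliftP ord0 i) => [k ->|->].
  by rewrite lift_perm_lift permE fE.
by rewrite lift_perm_id.
Qed.

Lemma prod_perm n (y : 'I_n -> R) (s : 'S_n) :
  (forall i k, y i * y k = - (y k * y i)) ->
  \prod_i y (s i) = (-1) ^+ odd_perm s * \prod_i y i.
Proof.
elim: n y s => [|n IH] y s hy.
  by rewrite !big_ord0 mulr1 (_ : s = 1%g) ?odd_perm1 //; apply/permP=> -[].
have [s' Es] := lift_permE s; rewrite {1}(prod_lift (s ord0) hy) big_ord_recl.
have -> : \prod_(i < n) y (s (lift ord0 i)) =
    (-1) ^+ odd_perm s' * \prod_(i < n) y (lift (s ord0) i).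
  rewrite -(IH (fun i => y (lift (s ord0) i))) //.
  by apply: eq_bigr => i _; rewrite {1}Es lift_perm_lift.
rewrite {3}Es odd_lift_perm /= signr_addb signr_odd !mulrA; congr (_ * _).
rewrite commr_sign; congr (_ * _); rewrite -!exprD -[RHS]signr_odd !oddD.
by rewrite addbAC addbb oddb.
Qed.

Variables (T : eqType) (y : T -> R).
Hypothesis hy : forall i k, y i * y k = - (y k * y i).

(** The sign of a sorting permutation is the sign by which a product of anticommuting
    elements changes when its factors are sorted. *)
Lemma prod_sort (A : {pred T}) (r : rel T) (s : seq T) :
  linear_order_on A r -> {subset s <= A} ->
  \prod_(t <- sort r s) y t = (-1) ^+ odd_perm (sorting_perm r s) * \prod_(t <- s) y t.
Proof.
move=> [tot anti tr] sA.
rewrite /sorting_perm; case: pickP => [p /= sp|/= nos].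
  have ps : perm_eq [seq tnth (in_tuple s) (p i) | i <- enum 'I_(size s)] s.
    by apply/(@tuple_permP _ _ _ (in_tuple s)); exists p.
  have psA : {subset [seq tnth (in_tuple s) (p i) | i <- enum 'I_(size s)] <= A}.
    by move=> t; rewrite (perm_mem ps) => /sA.
  have <- : [seq tnth (in_tuple s) (p i) | i <- enum 'I_(size s)] = sort r s.
    apply: (@sorted_eq_in _ r) => //.
    - by move=> a b c /psA ? /psA ? /psA ?; apply: tr.
    - by move=> a b /psA ? /psA ?; apply: anti.
    - by apply: (sort_sorted_in tot); apply/allP.
    - by rewrite (perm_trans ps) // perm_sym perm_sort.
  rewrite big_map enumT.
  rewrite [LHS](_ : _ = \prod_i y (tnth (in_tuple s) (p i))); last first.
    by rewrite [index_enum _]unlock.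
  rewrite (prod_perm (y := fun i => y (tnth (in_tuple s) i))) //.
  by rewrite [in RHS]big_tnth.
have /tuple_permP[p Ep] : perm_eq (sort r s) (in_tuple s) by rewrite perm_sort.
have {}Ep : [seq tnth (in_tuple s) (p i) | i <- enum 'I_(size s)] = sort r s by [].
have := nos p; rewrite Ep.
by rewrite (sort_sorted_in tot) //; apply/allP.
Qed.

End AnticommutingProducts.

(** * The exterior algebra on the atoms *)

(** The exterior algebra on a finite type is the free graded-commutative algebra with
    all its generators in degree one. *)

Section MonomialProducts.
Variables (R : fieldType) (K : finType) (deg : K -> nat).
Local Notation gen := (@gc_gen R K deg).

Lemma gc_prod_monom (I : Type) (s : seq I) (f : I -> gcalg R deg) (m : I -> {ffun K -> nat}) :
  (forall i, exists b : bool, f i = gc_monom deg ((-1) ^+ b) (m i)) ->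
  exists b : bool, \prod_(i <- s) f i =
    gc_monom deg ((-1) ^+ b) [ffun k => \sum_(i <- s) m i k]%N.
Proof.
move=> fm; elim: s => [|i s [b Eb]].
  exists false; rewrite big_nil [LHS]/(gc_monom deg 1 _); congr gc_monom.
  by apply/ffunP=> k; rewrite !ffunE big_nil.
have [c Ec] := fm i; pose n := [ffun k => \sum_(i <- s) m i k]%N.
exists (odd (c + b + gc_inv deg (m i) n)).
rewrite big_cons Ec Eb gc_monomM -/n -!exprD signr_odd; congr gc_monom.
by apply/ffunP=> k; rewrite !ffunE big_cons.
Qed.

End MonomialProducts.

Section ExteriorAlgebra.
Variables (R : fieldType) (T : finType).
Local Notation E := (gcalg R (fun _ : T => 1%N)).
Local Notation gen := (@gc_gen R T (fun=> 1%N)).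
Variable r : rel T.

(** The image of the product of the elements of U under the morphism of exterior
    algebras induced by p. *)
Definition wedge (p : T -> T) (U : {set T}) : E :=
  \prod_(t <- sort r (enum U)) gen (p t).

Lemma gen_anticomm (i j : T) : gen i * gen j = - (gen j * gen i).
Proof. by rewrite gc_gen_comm muln1 expr1 scaleN1r. Qed.

Lemma wedge1 p a : wedge p [set a] = gen (p a).
Proof. by rewrite /wedge enum_set1 big_seq1. Qed.

Definition fibre_card (p : T -> T) (U : {set T}) : {ffun T -> nat} :=
  [ffun k => #|[set t in U | p t == k]|].

(** Reordering the factors only costs a sign.  All the vanishing and nonvanishing
    statements about [wedge] are read off from its exponent vector: a generator of odd
    degree cannot occur twice. *)
Lemma wedge_monom p U : exists b : bool,
  wedge p U = gc_monom _ ((-1) ^+ b) (fibre_card p U).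
Proof.
have [|b Eb] := @gc_prod_monom R T (fun=> 1%N) _ (sort r (enum U))
  (fun t => gen (p t)) (fun t => [ffun k => (k == p t : nat)]).
  by move=> t; exists false.
exists b; rewrite /wedge Eb; congr gc_monom; apply/ffunP=> k; rewrite !ffunE.
rewrite (perm_big (enum U)) ?perm_sort //= big_enum -sum1_card /=.
under [RHS]eq_bigl do rewrite inE.
rewrite big_mkcondr; apply: eq_bigr => t _; rewrite ffunE eq_sym.
by case: eqP.
Qed.

Lemma wedge_eq0 p (U : {set T}) a b : a \in U -> b \in U -> a != b -> p a = p b ->
  wedge p U = 0.
Proof.
move=> aU bU ab pab; have [c ->] := wedge_monom p U; apply: gc_monomN.
rewrite negb_forall; apply/existsP; exists (p a); rewrite /= ffunE -leqNgt.
by apply/card_gt1P; exists a, b; rewrite !inE aU bU pab eqxx.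
Qed.

Lemma fibre_card_id p (U : {set T}) : {in U, p =1 id} ->
  fibre_card p U = [ffun k => (k \in U : nat)].
Proof.
move=> pU; apply/ffunP=> k; rewrite !ffunE; case: (boolP (k \in U)) => kU.
  have -> : [set t in U | p t == k] = [set k].
    apply/setP=> t; rewrite !inE; case: (boolP (t \in U)) => tU /=.
      by rewrite pU.
    by apply/esym/negbTE; apply: contraNneq tU => ->.
  by rewrite cards1.
apply/eqP; rewrite cards_eq0; apply/eqP/setP=> t; rewrite !inE.
by apply/negP=> /andP[tU]; rewrite pU // => /eqP tk; rewrite -tk tU in kU.
Qed.

Lemma mcoeff_gc_monom (K : finType) (deg : K -> nat) (c : R) (m : {ffun K -> nat})
  (n : rexp deg) : (gc_monom deg c m)@_n = if m == n then c else 0.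
Proof.
have [rm|nr] := boolP (reduced deg m).
  by rewrite (gc_monomE c (RExp rm)) mcoeffU -val_eqE /=; case: eqP.
rewrite gc_monomN // mcoeff0; case: eqP => // mn.
by move: nr; rewrite mn (valP n).
Qed.

Lemma reduced_indicator (U : {set T}) :
  reduced (fun _ : T => 1%N) [ffun k => (k \in U : nat)].
Proof. by apply/forallP=> k; rewrite ffunE; case: (k \in U). Qed.

Lemma wedge_id_neq0 p (U : {set T}) : {in U, p =1 id} ->
  (wedge p U)@_(RExp (reduced_indicator U)) != 0.
Proof.
move=> pU; have [b ->] := wedge_monom p U.
by rewrite mcoeff_gc_monom fibre_card_id // eqxx signr_eq0.
Qed.

End ExteriorAlgebra.

Lemma big_two (V : nmodType) (T : finType) (U : {set T}) (a b : T) (F : T -> V) :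
  a \in U -> b \in U -> a != b ->
  (forall t, t \in U -> t != a -> t != b -> F t = 0) ->
  \sum_(t in U) F t = F a + F b.
Proof.
move=> aU bU ab F0; rewrite (bigD1 a) //= (bigD1 b) ?bU 1?eq_sym //=.
by rewrite big1 ?addr0 // => t /andP[/andP[tU ta] tb]; apply: F0.
Qed.

Lemma collision (T : finType) (U : {set T}) (p : T -> T) :
  ~ {in U &, injective p} -> exists a b, [/\ a \in U, b \in U, a != b & p a = p b].
Proof.
move=> ninj; have [|/existsPn no] := boolP
  [exists a, [exists b, [&& a \in U, b \in U, a != b & p a == p b]]].
  by case/existsP=> a /existsP[b /and4P[aU bU ab /eqP pab]]; exists a, b.
case: ninj => a b aU bU pab; apply/eqP; apply: contraT => ab.
by have /existsPn/(_ b) := no a; rewrite aU bU ab pab eqxx.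
Qed.

Section ShuffleSigns.
Variables (T : finType).
Local Notation gen := (@gc_gen rat T (fun=> 1%N)).
Variables (A : {pred T}) (r : rel T).
Hypothesis lin : linear_order_on A r.
Local Notation wedge := (@wedge rat T r).
Local Notation sgn := (shuffle_sgn r).

Lemma shuffle_sgnK (U V : {set T}) : sgn U V * sgn U V = 1.
Proof. by rewrite -expr2 sqrr_sign. Qed.

Lemma wedge_mul p (U V : {set T}) : {subset U <= A} -> {subset V <= A} ->
  [disjoint U & V] -> wedge p U * wedge p V = sgn U V *: wedge p (U :|: V).
Proof.
move=> UA VA dUV; have [tot anti tr] := lin.
set s := sort r (enum U) ++ sort r (enum V).
have sA : {subset s <= A}.
  by move=> t; rewrite mem_cat !mem_sort !mem_enum => /orP[/UA|/VA].
have ps : perm_eq s (enum (U :|: V)).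
  apply: uniq_perm; rewrite ?enum_uniq //.
    rewrite cat_uniq !sort_uniq !enum_uniq andbT /=; apply/hasPn=> t.
    rewrite !mem_sort !mem_enum => tV; apply/negP=> tU.
    by have /pred0P/(_ t) := dUV; rewrite /= tU tV.
  by move=> t; rewrite mem_cat !mem_sort !mem_enum inE.
have hy (i k : T) : gen (p i) * gen (p k) = - (gen (p k) * gen (p i)).
  exact: gen_anticomm.
have := prod_sort (y := fun t => gen (p t)) hy lin sA.
have -> : sort r s = sort r (enum (U :|: V)).
  apply/perm_sort_inP: ps.
  - by move=> t u /sA ? /sA ?; apply: tot.
  - by move=> t u v /sA ? /sA ? /sA ?; apply: tr.
  - by move=> t u /sA ? /sA ?; apply: anti.
rewrite -/(wedge p _) /shuffle_sgn -/s big_cat => ->.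
by rewrite scaler_sign mulr_sign; case: odd_perm; rewrite ?opprK.
Qed.

(** Expand the product of all elements of U, starting with a then b, or with b then a,
    in the exterior algebra, where it does not vanish. *)
Lemma shuffle_sgn_swap (U : {set T}) a b : {subset U <= A} -> a \in U -> b \in U ->
  a != b ->
  sgn [set a] (U :\ a) * sgn [set b] (U :\ a :\ b) =
  - (sgn [set b] (U :\ b) * sgn [set a] (U :\ a :\ b)).
Proof.
move=> UA aU bU ab; pose D := U :\ a :\ b.
have DE : D = U :\ b :\ a by rewrite /D setDDl setUC -setDDl.
have mul c (V : {set T}) : c \in V -> {subset V <= A} ->
    gen c * wedge id (V :\ c) = sgn [set c] (V :\ c) *: wedge id V.
  move=> cV VA; rewrite -(wedge1 rat r id) wedge_mul ?setD1K //.
  - by move=> t /set1P->; apply: VA.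
  - by move=> t /setD1P[_]; apply: VA.
  - by rewrite disjoints1 !inE eqxx.
have sub c : {subset U :\ c <= A} by move=> t /setD1P[_]; apply: UA.
have mul2 c e : c \in U -> e \in U -> c != e ->
    gen c * (gen e * wedge id (U :\ c :\ e)) =
    (sgn [set c] (U :\ c) * sgn [set e] (U :\ c :\ e)) *: wedge id U.
  move=> cU eU ce; have eUc : e \in U :\ c by rewrite !inE eq_sym ce.
  by rewrite (mul e (U :\ c) eUc (sub c)) -scalerAr (mul c U cU UA) scalerA mulrC.
have Eab := mul2 a b aU bU ab.
have := mul2 b a bU aU; rewrite eq_sym ab -DE => /(_ isT) Eba.
apply/eqP; rewrite -addr_eq0.
have : (sgn [set a] (U :\ a) * sgn [set b] D +
        sgn [set b] (U :\ b) * sgn [set a] D) *: wedge id U = 0.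
  by rewrite scalerDl -Eab -Eba !mulrA gen_anticomm mulNr addNr.
move/eqP; rewrite scaler_eq0 => /orP[//|/eqP w0].
by have := @wedge_id_neq0 rat T r id U (fun _ _ => erefl); rewrite w0 mcoeff0 eqxx.
Qed.

(** This is the boundary of [wedge p U], which is zero.  If p identifies a and b, then
    only the two terms omitting one of them survive, and they are opposite by
    [shuffle_sgn_swap]. *)
Lemma wedge_boundary p (U : {set T}) : {subset U <= A} ->
  ~ {in U &, injective p} ->
  \sum_(t in U) sgn [set t] (U :\ t) *: wedge p (U :\ t) = 0.
Proof.
move=> UA ninj.
have [a [b [aU bU ab pab]]] := collision ninj.
rewrite (big_two aU bU ab).
  pose D := U :\ a :\ b; have DE : D = U :\ b :\ a by rewrite /D setDDl setUC -setDDl.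
  have mul c (V : {set T}) : c \in V -> {subset V <= A} ->
      wedge p V = sgn [set c] (V :\ c) *: (gen (p c) * wedge p (V :\ c)).
    move=> cV VA; rewrite -(wedge1 rat r p) wedge_mul ?setD1K //.
    - by rewrite scalerA shuffle_sgnK scale1r.
    - by move=> t /set1P->; apply: VA.
    - by move=> t /setD1P[_]; apply: VA.
    - by rewrite disjoints1 !inE eqxx.
  have sub c : {subset U :\ c <= A} by move=> t /setD1P[_]; apply: UA.
  have bUa : b \in U :\ a by rewrite !inE eq_sym ab.
  have aUb : a \in U :\ b by rewrite !inE ab.
  rewrite (mul b (U :\ a) bUa (sub a)) (mul a (U :\ b) aUb (sub b)).
  rewrite -DE -/D pab !scalerA -scalerDl.
  by rewrite shuffle_sgn_swap // addNr scale0r.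
move=> t tU ta tb; rewrite (@wedge_eq0 _ _ r p _ a b) ?scaler0 //.
  by rewrite !inE eq_sym ta.
by rewrite !inE eq_sym tb.
Qed.

End ShuffleSigns.

Section WedgeProducts.
Variables (T : finType) (r : rel T) (p : T -> T).
Local Notation E := (gcalg rat (fun _ : T => 1%N)).
Local Notation gen := (@gc_gen rat T (fun=> 1%N)).
Local Notation wedge := (@wedge rat T r p).

(** Graded commutativity with z passes from the generators to products; [e] is the
    degree of z. *)
Lemma prod_gen_comm (s : seq T) (z : E) (e : nat) :
  (forall t, gen (p t) * z = (-1) ^+ e *: (z * gen (p t))) ->
  (\prod_(t <- s) gen (p t)) * z =
  (-1) ^+ (size s * e) *: (z * \prod_(t <- s) gen (p t)).
Proof.
move=> hz; elim: s => [|t s IH]; first by rewrite big_nil; exact: scomm1l.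
by rewrite big_cons /= mulSn; exact: scommMl (hz t) IH.
Qed.

Lemma wedge_comm (U V : {set T}) :
  wedge U * wedge V = (-1) ^+ (#|U| * #|V|) *: (wedge V * wedge U).
Proof.
have sz (W : {set T}) : size (sort r (enum W)) = #|W| by rewrite size_sort -cardE.
rewrite -!sz; apply: prod_gen_comm => t; apply: scommC.
rewrite -[size _]muln1; apply: prod_gen_comm => u; rewrite expr1 scaleN1r.
exact: gen_anticomm.
Qed.

Lemma wedge_mul_meet (U V : {set T}) t : t \in U -> t \in V -> wedge U * wedge V = 0.
Proof.
move=> tU tV; have [b ->] := wedge_monom rat r p U; have [c ->] := wedge_monom rat r p V.
rewrite gc_monomM; apply: gc_monomN; rewrite negb_forall; apply/existsP; exists (p t).
have pos (W : {set T}) : t \in W -> (0 < fibre_card p W (p t))%N.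
  by move=> tW; rewrite ffunE; apply/card_gt0P; exists t; rewrite inE tW eqxx.
rewrite /= ffunE -leqNgt; exact: (leq_add (pos U tU) (pos V tV)).
Qed.

End WedgeProducts.

(** * A morphism to the exterior algebra that kills the Orlik-Solomon ideal *)

Section BooleanQuotient.
Context {d : Order.disp_t} {P : finBPOrderType d} (rho : P -> nat).
Hypothesis LG : locally_geometric rho.
Variable lea : rel P.
Hypothesis lin : linear_order_on (mem (atoms rho)) lea.
Variable a : simp rho.
Local Notation x := (top_of a).
Local Notation S := (simp rho).
Local Notation L := (gcalg rat (fun _ : P => 1%N)).
Local Notation w b := (wedge rat lea (layer lea a) (at_of b)).

(** The intended image of e_b: only the elements below x contribute, and their atoms
    are replaced by the elements of A in the same layer. *)
Definition restrict_val (b : S) : L := if (top_of b <= x)%O then w b else 0.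

Lemma os_eE (b : S) (ib : indep_pos b) : os_e b = gc_gen rat _ (Sub b ib : osgen rho).
Proof. by rewrite /os_e insubT. Qed.

Lemma at_sub (b : S) : {subset at_of b <= mem (atoms rho)}.
Proof. by move=> t; apply: (subsetP (at_atoms b)). Qed.

Lemma wedge_dep (b : S) : (top_of b <= x)%O -> ~~ indep b -> w b = 0.
Proof.
move=> bx; rewrite (indepE LG bx) => nb.
have [|s [t [sb tb st e]]] := @collision _ (at_of b) (layer lea a); last first.
  exact: wedge_eq0 sb tb st e.
move=> inj; case/negP: nb; apply: (layer_inj_indep_set LG lin) => //.
  exact: at_atoms.
exact: below_at.
Qed.

Lemma restrict_hom_exists : exists phi : {lrmorphism osalg rho -> L},
  forall b : S, indep_pos b -> phi (os_e b) = restrict_val b.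
Proof.
have [|k ok|] := @gc_free rat (osgen rho) (fun k => #|at_of (val k)|) L
  (fun k => restrict_val (val k)).
- move=> i j; rewrite /restrict_val.
  case: ifP => _; last by rewrite mul0r mulr0 scaler0.
  case: ifP => _; last by rewrite mul0r mulr0 scaler0.
  exact: wedge_comm.
- rewrite /restrict_val; case: ifP => _; last by rewrite expr0n.
  rewrite expr2; have /card_gt0P[t tk] : (0 < #|at_of (val k)|)%N.
    by case: #|_| ok.
  exact: (wedge_mul_meet _ _ tk tk).
move=> [phi phiE] _; exists phi => b ib.
by rewrite (os_eE ib) phiE.
Qed.

Variable phi : {lrmorphism osalg rho -> L}.
Hypothesis phiE : forall b : S, indep_pos b -> phi (os_e b) = restrict_val b.

Lemma restrict_mono g : os_mono g -> phi g = 0.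
Proof.
move=> [b [c [ib ic m ->]]]; rewrite rmorphM /= !phiE // /restrict_val.
case: ifP => _; last by rewrite mul0r.
case: ifP => _; last by rewrite mulr0.
move: m; rewrite meets_bot // => /pred0Pn[t /= /andP[tb tc]].
exact: (wedge_mul_meet _ _ tb tc).
Qed.

Lemma indep_pos_join (b c e : S) : indep_pos b -> e \in joins [set b; c] -> indep e ->
  indep_pos e.
Proof.
move=> /andP[_ b0] /(joins_at LG)[be _ _] ie; rewrite /indep_pos ie.
by apply: contraNneq b0 => e0; rewrite -lex0 -e0.
Qed.

(** If b and c lie below x, exactly one of their joins does, and it has the same image
    as the product of b and c, which is zero when that join is dependent.  Otherwise no
    join lies below x. *)
Lemma restrict_join g : os_join lea g -> phi g = 0.
Proof.
move=> [b [c [ib ic /eqP m ->]]]; rewrite meets_bot // in m.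
have Es : phi (\sum_(e in joins [set b; c] | indep e) os_e e) =
    \sum_(e in joins [set b; c] | indep e) restrict_val e.
  rewrite raddf_sum /=; apply: eq_bigr => e /andP[ej ie].
  by rewrite phiE // (indep_pos_join ib ej ie).
rewrite raddfB /= rmorphM linearZ /= Es !phiE //.
have not_below0 (e : S) : e \in joins [set b; c] ->
    ~~ ((top_of b <= x)%O && (top_of c <= x)%O) -> restrict_val e = 0.
  move=> /(joins_at LG)[be ce _]; rewrite /restrict_val; case: ifP => // ex.
  by rewrite (le_trans (top_le be) ex) (le_trans (top_le ce) ex).
have [/andP[bx cx]|nbc] := boolP ((top_of b <= x)%O && (top_of c <= x)%O); last first.
  rewrite big1 ?scaler0 ?subr0; last by move=> e /andP[ej _]; apply: not_below0.
  move: nbc; rewrite negb_and /restrict_val => /orP[]/negPf->.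
    by rewrite mul0r.
  by rewrite mulr0.
have [e [ej ex euniq]] := joins_below LG bx cx; have [_ _ ee] := joins_at LG ej.
rewrite {1 2}/restrict_val bx cx (wedge_mul lin _ (@at_sub b) (@at_sub c) m) -ee.
have out f : f \in joins [set b; c] -> f != e -> restrict_val f = 0.
  move=> fj fe; rewrite /restrict_val; case: ifP => // fx.
  by rewrite (euniq f fj fx) eqxx in fe.
have -> : \sum_(f in joins [set b; c] | indep f) restrict_val f = w e.
  have [ie|die] := boolP (indep e).
    rewrite (bigD1 e) ?ej //= big1 ?addr0; first by rewrite /restrict_val ex.
    by move=> f /andP[/andP[fj _] fe]; apply: out.
  rewrite big1 ?wedge_dep // => f /andP[fj jf]; apply: out => //.
  by apply: contraTneq jf => ->.
by rewrite subrr.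
Qed.

Lemma indep_pos_del (u z : S) t : unicircular z u -> t \in at_of z ->
  indep_pos (del u t).
Proof.
move=> uz tz; rewrite /indep_pos (unicircular_del_indep LG uz tz) /=.
rewrite -(at_set0 LG); have [_ ->] := delP LG u t.
have /and3P[cz zu _] := uz; rewrite -card_gt0 -ltnS.
have tu : t \in at_of u by apply: (subsetP (at_le zu)).
have := cardsD1 t (at_of u); rewrite tu add1n => <-.
exact: leq_trans (circuit_card LG cz) (subset_leq_card (at_le zu)).
Qed.

(** All the deletions that occur have the same join as u, so they are all killed when u
    is not below x.  Otherwise the relation becomes a boundary once the sum is extended
    to all the atoms of u; the added terms vanish, as they omit an atom outside of the
    circuit and hence are images of dependent elements. *)
Lemma restrict_circ g : os_circ lea g -> phi g = 0.
Proof.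
move=> [z [u [uz ->]]]; have /and3P[cz zu _] := uz; rewrite raddf_sum /=.
have [ux|nux] := boolP (top_of u <= x)%O; last first.
  rewrite big1 // => t tz; rewrite linearZ /= phiE ?(indep_pos_del uz) //.
  by rewrite /restrict_val (circuit_del_top_above LG cz zu tz) (negPf nux) scaler0.
have dx t : (top_of (del u t) <= x)%O.
  by apply: le_trans ux; apply: top_le; have [] := delP LG u t.
have nu : ~~ indep u by apply: contra (circuit_dep cz); apply: indepS.
have ninj : ~ {in at_of u &, injective (layer lea a)}.
  move=> inj; case/negP: nu; rewrite (indepE LG ux).
  apply: (layer_inj_indep_set LG lin) => //; first exact: at_atoms.
  exact: below_at.
rewrite -[RHS](wedge_boundary lin (@at_sub u) ninj).
rewrite [RHS](big_setID (at_of z)) /= (setIidPr (at_le zu)).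
rewrite [X in _ = _ + X]big1 ?addr0.
  apply: eq_bigr => t tz; rewrite linearZ /= (phiE (indep_pos_del uz tz)).
  by rewrite /restrict_val dx /os_sgn; have [_ ->] := delP LG u t.
move=> t /setDP[tu tz]; have [du ed] := delP LG u t.
rewrite -ed wedge_dep ?scaler0 //; apply: contra (circuit_dep cz); apply: indepS => //.
rewrite (le_simpE LG (top_le zu) (top_le du)) ed subsetD1 at_le //.
Qed.

Lemma restrict_ideal g : os_ideal lea g -> phi g = 0.
Proof.
elim=> [f [/restrict_mono|/restrict_join|/restrict_circ]|
       |f h _ f0 _ h0|b f _ f0|f b _ f0] //.
- by rewrite raddf0.
- by rewrite raddfD /= f0 h0 addr0.
- by rewrite rmorphM /= f0 mulr0.
- by rewrite rmorphM /= f0 mul0r.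
Qed.

End BooleanQuotient.

(** * Monomials of a free graded-commutative algebra *)

(** The exponent vector of a generator.  It is locked so that comparing two of them
    does not unfold the decidable equality on the generators. *)
HB.lock Definition single (K : finType) (k : K) : {ffun K -> nat} :=
  [ffun i => (i == k : nat)].

Section Monomials.
Variables (R : fieldType) (K : finType) (deg : K -> nat) (le : rel K).
Local Notation gen := (@gc_gen R K deg).

Lemma singleE (k i : K) : single k i = (i == k).
Proof. by rewrite single.unlock ffunE. Qed.

Lemma gc_genE (k : K) : gen k = gc_monom deg 1 (single k).
Proof. by rewrite single.unlock. Qed.

Lemma expDE (m n : {ffun K -> nat}) k : expD m n k = (m k + n k)%N.
Proof. by rewrite ffunE. Qed.

Lemma reduced_le (m n : {ffun K -> nat}) :
  (forall k, m k <= n k)%N -> reduced deg n -> reduced deg m.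
Proof.
move=> mn /forallP rn; apply/forallP=> k; apply/implyP=> ok.
exact: leq_ltn_trans (mn k) (implyP (rn k) ok).
Qed.

Lemma monomE (m : rexp deg) : exists b : bool,
  @monom R K deg le m = gc_monom deg ((-1) ^+ b) m.
Proof.
have [|b Eb] := @gc_prod_monom R K deg _ (sort le (enum K))
  (fun k => gen k ^+ m k) (fun k => [ffun i => (m k * (i == k))%N]).
  by move=> k; exists false; rewrite gc_genX.
exists b; rewrite /monom Eb; congr gc_monom; apply/ffunP=> i; rewrite ffunE.
rewrite (perm_big (enum K)) ?perm_sort //= big_enum (bigD1 i) //= ffunE eqxx muln1.
by rewrite big1 ?addn0 // => k ki; rewrite ffunE eq_sym (negPf ki) muln0.
Qed.

Lemma monom_dvd (m n : rexp deg) : (forall k, n k <= m k)%N ->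
  exists a, @monom R K deg le m = a * @monom R K deg le n.
Proof.
move=> nm; have [b ->] := monomE m; have [c ->] := monomE n.
pose p : {ffun K -> nat} := [ffun k => (m k - n k)%N].
have pn : expD p n = m by apply/ffunP=> k; rewrite !ffunE subnK.
pose i := gc_inv deg p n.
have sg : (-1) ^+ (b + c + i)%N * (-1) ^+ c * (-1) ^+ i = (-1) ^+ b :> R.
  rewrite -!exprD -[LHS]signr_odd !oddD; congr (_ ^+ nat_of_bool _).
  by case: (odd i); case: (b); case: (c).
by exists (gc_monom deg ((-1) ^+ (b + c + i)%N) p); rewrite gc_monomM pn sg.
Qed.

Lemma mcoeff_gen (k : K) (n : rexp deg) : (gen k)@_n = (single k == n)%:R.
Proof. by rewrite gc_genE mcoeff_gc_monom; case: eqP. Qed.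

Lemma mcoeff_sum_gc (I : Type) (s : seq I) (Q : pred I) (F : I -> gcalg R deg)
  (n : rexp deg) : (\sum_(i <- s | Q i) F i)@_n = \sum_(i <- s | Q i) (F i)@_n.
Proof. by rewrite (raddf_sum (mcoeff n)). Qed.

Lemma gc_expand (g : gcalg R deg) :
  g = \sum_(n <- msupp g) g@_n *: gc_monom deg 1 n.
Proof. by rewrite -{1}(gc_lift_id g). Qed.

Lemma monom_deg_single (m : rexp deg) k : expo m = single k -> monom_deg m = deg k.
Proof.
rewrite /monom_deg => ->; rewrite (bigD1 k) //= big1 => [|i ik]; rewrite singleE.
  by rewrite eqxx mul1n addn0.
by rewrite (negPf ik).
Qed.

(** The monomials that no product of two generators divides are 1 and the single
    generators. *)
Lemma rexp_cases (m : rexp deg) :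
  [\/ exists i j, [/\ i != j, 0 < m i & 0 < m j]%N,
      exists i, (1 < m i)%N,
      exists k, expo m = single k
    | forall k, m k = 0%N].
Proof.
have [/existsP[i mi]|/existsPn m1] := boolP [exists i, 1 < m i]%N.
  by apply: Or42; exists i.
have [/existsP[k mk]|/existsPn m0] := boolP [exists k, 0 < m k]%N; last first.
  by apply: Or44 => k; apply/eqP; rewrite -leqn0 leqNgt.
have [/existsP[j /andP[kj mj]]|/existsPn mj] := boolP [exists j, (k != j) && (0 < m j)%N].
  by apply: Or41; exists k, j.
apply: Or43; exists k; apply/ffunP=> i; rewrite singleE.
have [->|ik] := eqVneq i k; first by apply/eqP; rewrite eqn_leq mk leqNgt m1.
by have := mj i; rewrite eq_sym ik /= lt0n negbK => /eqP.
Qed.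

Lemma rexp_inj (m n : rexp deg) : expo m = expo n -> m = n.
Proof. exact: val_inj. Qed.

End Monomials.

Section Homogeneous.
Variables (T : finType).
Local Notation E := (gcalg rat (fun _ : T => 1%N)).

(** A scalar multiple of a monomial of degree e.  Zero has to be allowed, being the
    image of the generators that are not below x. *)
Definition homogeneous_monomial (e : nat) (v : E) : Prop :=
  v = 0 \/ exists c (m : {ffun T -> nat}), v = gc_monom _ c m /\ (\sum_k m k = e)%N.

Lemma homogeneous1 : homogeneous_monomial 0 1.
Proof.
by right; exists 1, [ffun=> 0%N]; split=> //; rewrite big1 // => k _; rewrite ffunE.
Qed.

Lemma homogeneousM e1 e2 v1 v2 : homogeneous_monomial e1 v1 ->
  homogeneous_monomial e2 v2 -> homogeneous_monomial (e1 + e2) (v1 * v2).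
Proof.
case=> [->|[c [m [-> em]]]]; first by left; rewrite mul0r.
case=> [->|[c' [m' [-> em']]]]; first by left; rewrite mulr0.
right; rewrite gc_monomM; eexists; eexists; split; first reflexivity.
by rewrite -em -em' -big_split; apply: eq_bigr => k _; rewrite ffunE.
Qed.

Lemma homogeneousX e v n : homogeneous_monomial e v ->
  homogeneous_monomial (n * e) (v ^+ n).
Proof.
move=> hv; elim: n => [|n IH]; first exact: homogeneous1.
by rewrite exprS mulSn; apply: homogeneousM.
Qed.

Lemma homogeneous_prod (I : Type) (s : seq I) (e : I -> nat) (v : I -> E) :
  (forall i, homogeneous_monomial (e i) (v i)) ->
  homogeneous_monomial (\sum_(i <- s) e i) (\prod_(i <- s) v i).
Proof.
move=> hv; elim: s => [|i s IH]; first by rewrite !big_nil; exact: homogeneous1.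
by rewrite !big_cons; apply: homogeneousM.
Qed.

Lemma homogeneous_wedge (r : rel T) p (U : {set T}) :
  homogeneous_monomial #|U| (wedge rat r p U).
Proof.
have [b ->] := wedge_monom rat r p U; right; exists ((-1) ^+ b), (fibre_card p U).
split=> //; rewrite -[RHS]sum1_card [RHS](partition_big p predT) //=.
apply: eq_bigr => k _; rewrite ffunE -sum1_card; apply: eq_bigl => t.
by rewrite inE.
Qed.

Lemma mcoeff_homogeneous e v (n : rexp (fun _ : T => 1%N)) :
  homogeneous_monomial e v -> v@_n != 0 -> (\sum_k n k = e)%N.
Proof.
case=> [->|[c [m [-> <-]]]]; first by rewrite mcoeff0 eqxx.
rewrite mcoeff_gc_monom; case: (m =P n) => [mn _|]; last by rewrite eqxx.
by rewrite -mn.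
Qed.

End Homogeneous.

(** * Leading monomials *)

Section GroebnerBasis.
Context {d : Order.disp_t} {P : finBPOrderType d} (rho : P -> nat).
Variables (lea : rel P) (les : rel (simp rho)).
Hypothesis LG : locally_geometric rho.
Hypothesis lin : linear_order_on (mem (atoms rho)) lea.
Hypothesis star : star_order lea les.

Local Notation S := (simp rho).
Local Notation K := (osgen rho).
Local Notation deg := (fun k : K => #|at_of (val k)|).
Local Notation E := (gcalg rat deg).
Local Notation le := (osgen_le les).
Local Notation mon := (@monom rat K deg le).

Lemma gen_indep (k : K) : indep (val k).
Proof. by have /andP[] := valP k. Qed.

Lemma os_e_val (k : K) : os_e (val k) = gc_gen rat deg k.
Proof. by rewrite /os_e valK. Qed.

Lemma les_card (i j : K) : le i j -> (deg i <= deg j)%N.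
Proof.
have [[_ anti _] _ card _] := star; move=> ij; rewrite leqNgt; apply/negP=> ji.
have e : val i = val j.
  apply: (anti _ _ (gen_indep i) (gen_indep j)); apply/andP; split=> //.
  exact: card (gen_indep j) (gen_indep i) ji.
by rewrite e ltnn in ji.
Qed.

Lemma les_anti (i j : K) : le i j -> le j i -> i = j.
Proof.
have [[_ anti _] _ _ _] := star; move=> ij ji; apply: val_inj.
by apply: (anti _ _ (gen_indep i) (gen_indep j)); apply/andP.
Qed.

Lemma les_total (i j : K) : le i j || le j i.
Proof. by have [[tot _ _] _ _ _] := star; apply: tot; apply: gen_indep. Qed.

Lemma les_refl (i : K) : le i i.
Proof. by have := les_total i i; rewrite orbb. Qed.

Lemma deg_gt0 (k : K) : (0 < deg k)%N.
Proof. by have /andP[_] := valP k; rewrite card_gt0 (at_set0 LG). Qed.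

(** In equal degrees, n is smaller than m as soon as both vanish before k and m has the
    larger exponent at k. *)
Lemma monom_lt_singleP (m n : rexp deg) (k : K) : (n k < m k)%N ->
  monom_deg n = monom_deg m ->
  (forall j, j != k -> le j k -> n j = 0%N /\ m j = 0%N) -> monom_lt le n m.
Proof.
move=> nm dnm H; rewrite /monom_lt dnm eqxx ltnn /=; apply/existsP; exists k.
rewrite nm; apply/forall_inP=> j jk; apply/implyP=> jlk.
by have [-> ->] := H j jk jlk.
Qed.

(** In a given degree the order puts a product above every single generator: all
    the factors of a product have smaller degree and so come first.  Hence a
    monomial of the degree of k supported beyond k cannot be a proper product. *)
Lemma single_of_later_support (n : rexp deg) (k : K) : monom_deg n = deg k ->
  (forall j, le j k -> n j = 0%N) ->
  exists j, [/\ expo n = single j, ~~ le j k & deg j = deg k].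
Proof.
move=> dn n0.
have [/existsP[j nj]|/existsPn nj] := boolP [exists j, 0 < n j]%N; last first.
  have := deg_gt0 k; rewrite -dn /monom_deg big1 // => j _.
  by have := nj j; rewrite -eqn0Ngt => /eqP->.
have nlj : ~~ le j k by apply: contraL nj => /n0->.
have klj : le k j by have := les_total j k; rewrite (negPf nlj).
have dj : (deg k <= deg j)%N := les_card klj.
have split_deg : (n j * deg j + \sum_(i | i != j) n i * deg i = deg k)%N.
  by rewrite -dn /monom_deg [RHS](bigD1 j).
have nj1 : n j = 1%N.
  apply/eqP; rewrite eqn_leq nj andbT -(leq_pmul2r (deg_gt0 j)) mul1n.
  by apply: leq_trans dj; rewrite -split_deg leq_addr.
have djk : deg j = deg k.
  by apply/eqP; rewrite eqn_leq dj andbT -split_deg nj1 mul1n leq_addr.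
exists j; split=> //; apply/ffunP=> i; rewrite singleE; case: eqP => [->//|/eqP ij].
move: split_deg; rewrite nj1 mul1n djk => /eqP; rewrite -[X in _ == X]addn0 eqn_add2l.
rewrite sum_nat_eq0 => /forallP/(_ i); rewrite ij muln_eq0.
by rewrite [_ == 0 in X in _ || X]eqn0Ngt deg_gt0 orbF => /eqP.
Qed.

(** When i and j share an atom, their product is itself in the basis.  Otherwise
    it is the leading term of the join relation, whose other terms are single
    generators of the same degree as the product. *)
Lemma leading_pair (i j : K) (q : rexp deg) : ~~ ((i == j) && odd (deg i)) ->
  expo q = expD (single i) (single j) ->
  leading_monoms le (os_basis lea) (mon q).
Proof.
move=> nz Eq; have [ib ic] := (valP i, valP j).
have [s Es] : exists s : rat, s != 0 /\ os_e (val i) * os_e (val j) = gc_monom deg s q.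
  exists (1 * 1 * (-1) ^+ gc_inv deg (single i) (single j)).
  split; first by rewrite !mul1r signr_eq0.
  by rewrite Eq !os_e_val !gc_genE; apply: gc_monomM.
have {Es} [s0 Es] := Es.
have cs n : (gc_monom deg s q)@_n = if q == n then s else 0.
  by rewrite mcoeff_gc_monom val_eqE.
have [/eqP m|m] := boolP (meets [set val i; val j] == [set \bot%O]); last first.
  exists (gc_monom deg s q); split.
  - by apply: Or31; exists (val i), (val j); split=> //; rewrite -?Es ?val_eqE.
  - by apply: contraNneq s0 => e0; have := cs q; rewrite e0 mcoeff0 eqxx => <-.
  - exists q; split=> //; first by rewrite -mcoeff_neq0 cs eqxx.
    move=> n; rewrite -mcoeff_neq0 cs.
    by have [->|_] := eqVneq q n; rewrite ?eqxx.
have dis : [disjoint at_of (val i) & at_of (val j)] by rewrite -(meets_bot LG) m.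
set J := joins [set val i; val j].
pose g : E := gc_monom deg s q - os_sgn lea (at_of (val i)) (at_of (val j)) *:
  \sum_(c in J | indep c) os_e c.
have Jpos c : c \in J -> indep c -> indep_pos c.
  by move=> cJ; apply: indep_pos_join LG _ _ _ ib cJ.
have Jdeg c : c \in J -> #|at_of c| = (deg i + deg j)%N.
  by move=> /(joins_at LG)[_ _ ->]; rewrite cardsU (disjoint_setI0 dis) cards0 subn0.
have ltJ (c : K) : val c \in J -> (deg i < deg c)%N /\ (deg j < deg c)%N.
  move=> cJ; rewrite (Jdeg _ cJ) -[X in (X < _)%N /\ _]addn0 -[X in _ /\ (X < _)%N]add0n.
  by rewrite ltn_add2l ltn_add2r !deg_gt0.
have sumJ n : (\sum_(c in J | indep c) os_e c : E)@_n != 0 ->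
    exists2 c : K, val c \in J & expo n = single c.
  rewrite mcoeff_sum_gc => H.
  have [/existsP[c /andP[cJ /eqP nc]]|/existsPn no] :=
    boolP [exists c : K, (val c \in J) && (expo n == single c)]; first by exists c.
  case/eqP: H; apply: big1 => c /andP[cJ ic'].
  rewrite (os_eE (Jpos c cJ ic')) mcoeff_gen; case: eqP => // e.
  by have := no (Sub c (Jpos c cJ ic')); rewrite SubK cJ e eqxx.
have qE l : q l = ((l == i) + (l == j))%N by rewrite Eq expDE !singleE.
have qnJ (c : K) : val c \in J -> expo q <> single c.
  move=> cJ e; have [ic' _] := ltJ c cJ; have := qE i; rewrite e singleE eqxx.
  by case: eqP => // ec; rewrite -ec ltnn in ic'.
have gq : g@_q = s.
  rewrite mcoeffB mcoeffZ cs eqxx.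
  have [->|/sumJ[c /qnJ]//] := eqVneq (\sum_(c in J | indep c) os_e c : E)@_q 0.
  by rewrite mulr0 subr0.
exists g; split.
- by apply: Or32; exists (val i), (val j); split=> //; rewrite Es.
- by apply: contraNneq s0 => g0; rewrite -gq g0 mcoeff0.
exists q; split=> //; first by rewrite -mcoeff_neq0 gq.
move=> n; rewrite -mcoeff_neq0 => gn nq.
have [|c cJ nc] := sumJ n.
  apply: contraNneq gn => e; rewrite mcoeffB mcoeffZ e mulr0 subr0 cs.
  by rewrite [q == n]eq_sym (negPf nq).
have ij : i != j.
  apply: contraTneq dis => ->; rewrite -setI_eq0 setIid -card_gt0; exact: deg_gt0.
have dq : monom_deg n = monom_deg q.
  rewrite (monom_deg_single nc) (Jdeg _ cJ) /monom_deg (bigD1 i) //= (bigD1 j) 1?eq_sym //=.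
  rewrite !qE !eqxx (negPf ij) eq_sym (negPf ij) !mul1n big1 ?addn0 // => k /andP[ki kj].
  by rewrite qE (negPf ki) (negPf kj).
have [lic ljc] := ltJ c cJ.
have nE l : n l = (l == c) by rewrite nc singleE.
have notc (l k : K) : (deg k < deg c)%N -> le l k -> n l = 0%N.
  by move=> kc /les_card lk; rewrite nE; case: eqP => // lc; rewrite lc leqNgt kc in lk.
(* The exponents of n and q first differ at the earlier one of i and j. *)
have /orP[lij|lji] := les_total i j.
- apply: (@monom_lt_singleP _ _ i) => //.
    by rewrite (notc i i) // ?qE ?eqxx // les_refl.
  move=> l li lli; split; first exact: (notc l i).
  rewrite qE (negPf li); case: eqP => // lj; case/eqP: li; rewrite lj in lli *.
  exact: les_anti.
- apply: (@monom_lt_singleP _ _ j) => //.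
    rewrite (notc j j) // ?qE ?eqxx ?addn1 ?les_refl //.
  move=> l lj llj; split; first exact: (notc l j).
  rewrite qE (negPf lj) addn0; case: eqP => // li; case/eqP: lj; rewrite li in llj *.
  exact: les_anti.
Qed.

(** Among the deletions of w at atoms of the circuit, the one at the smallest atom t is
    the first in the order on independent elements: t is in all the others.  The first
    generator is the largest monomial. *)
Lemma leading_circuit (w z : S) t (k : K) (m : rexp deg) : unicircular z w ->
  t \in at_of z -> del w t = val k -> {in at_of z, forall u, lea t u} ->
  expo m = single k -> leading_monoms le (os_basis lea) (mon m).
Proof.
move=> uz tz dk tmin Em; have /and3P[_ zw _] := uz.
have [_ _ _ lex] := star.
have tw u : u \in at_of z -> u \in at_of w by apply: (subsetP (at_le zw)).
have atd u : at_of (del w u) = at_of w :\ u by have [] := delP LG w u.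
have degd u : u \in at_of z -> #|at_of (del w u)| = #|at_of w|.-1.
  by move=> uu; rewrite atd (cardsD1 u (at_of w)) tw.
pose g : E := \sum_(u in at_of z)
  os_sgn lea [set u] (at_of (del w u)) *: os_e (del w u).
have coef n : g@_n = \sum_(u in at_of z)
    os_sgn lea [set u] (at_of (del w u)) * (os_e (del w u) : E)@_n.
  by rewrite mcoeff_sum_gc; apply: eq_bigr => u _; rewrite mcoeffZ.
have coef1 u n : u \in at_of z -> (os_e (del w u) : E)@_n != 0 ->
    exists2 c : K, val c = del w u & expo n = single c.
  move=> uu; rewrite (os_eE (indep_pos_del LG uz uu)) mcoeff_gen.
  case: (single _ =P expo n) => [e _|_]; last by rewrite eqxx.
  by exists (Sub (del w u) (indep_pos_del LG uz uu)); rewrite ?SubK.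
have del_inj u : u \in at_of z -> del w u = del w t -> u = t.
  move=> uu e; apply/eqP; apply: contraT => ut.
  by have := setD11 u (at_of w); rewrite -atd e atd !inE ut tw.
have gm : g@_m != 0.
  rewrite coef (bigD1 t) //= big1 ?addr0 => [|u /andP[uu ut]].
    by rewrite mulf_neq0 ?signr_eq0 // dk os_e_val mcoeff_gen Em eqxx oner_eq0.
  have [->|/(coef1 u m uu)[c ec nc]] := eqVneq (os_e (del w u) : E)@_m 0.
    by rewrite mulr0.
  move: ut; rewrite (del_inj u uu) ?eqxx // -ec dk; congr val.
  have := nc; rewrite Em => /ffunP/(_ c); rewrite !singleE eqxx.
  by case: eqP.
exists g; split; first by apply: Or33; exists z, w.
  by apply: contraNneq gm => ->; rewrite mcoeff0.
exists m; split=> //; first by rewrite -mcoeff_neq0.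
move=> n; rewrite -mcoeff_neq0 => gn nm.
have [u uu [c ec nc]] : exists2 u, u \in at_of z &
    exists2 c : K, val c = del w u & expo n = single c.
  have [/existsP[u /andP[uu /(coef1 u n uu) cu]]|/existsPn no] :=
    boolP [exists u, (u \in at_of z) && ((os_e (del w u) : E)@_n != 0)].
    by exists u.
  case/eqP: gn; rewrite coef big1 // => u uu; have := no u.
  by rewrite uu negbK => /eqP->; rewrite mulr0.
have ck : c != k.
  by apply: contraNneq nm => ck; apply/eqP/rexp_inj; rewrite nc Em ck.
apply: (@monom_lt_singleP _ _ k).
- by rewrite nc Em !singleE eqxx eq_sym (negPf ck).
- by rewrite (monom_deg_single nc) (monom_deg_single Em) ec -dk !degd.
move=> j jk jlk; rewrite nc Em !singleE (negPf jk); split=> //.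
case: eqP => // jc; case/eqP: ck; rewrite jc in jlk; apply: les_anti => //.
apply: (lex _ _ (gen_indep _) (gen_indep _)); rewrite -dk ec ?degd //.
have ut : u != t by apply: contraNneq nm => ut; apply/eqP/rexp_inj; rewrite nc Em;
  congr single; apply: val_inj; rewrite ec ut dk.
exists t; first by rewrite in_setD !atd !inE eqxx eq_sym ut tw.
move=> v; rewrite !atd !inE; have [->|vt] := eqVneq v t; first by rewrite tmin.
have [->|vu] := eqVneq v u; first by rewrite tmin.
by rewrite /= andNb.
Qed.

Lemma nbcP (a : S) : nbc lea a \/
  exists t s, [/\ t \in atoms rho, (t <= top_of a)%O, in_tail_span lea a t s & ~~ lea s t].
Proof.
have [/existsP[t /existsP[s /and4P[h1 h2 h3 h4]]]|/existsPn no] := boolP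
  [exists t, [exists s, [&& t \in atoms rho, (t <= top_of a)%O, in_tail_span lea a t s
    & ~~ lea s t]]].
  by right; exists t, s.
left=> t tat s tx cs; have /existsPn/(_ s) := no t.
by rewrite tat tx cs /= negbK.
Qed.

(** The hypothesis on m makes it the monomial of the generator a, or the monomial 1
    when a is the bottom.  Apply the morphism attached to a and look at the coefficient
    of the product of the atoms of a: monomials of smaller degree do not reach it, and
    those of the same degree that are smaller than m are generators coming after a,
    whereas the generators other than a that do reach it come before a. *)
Lemma nbc_not_leading (a : S) (g : E) (m : rexp deg) : indep a -> nbc lea a ->
  os_ideal lea g -> (forall k, m k = (val k == a : nat)) -> m \in msupp g ->
  ~ {in msupp g, forall n, n != m -> monom_lt le n m}.
Proof.
move=> ia na Jg Em mg mlead; have [phi phiE] := restrict_hom_exists lea a.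
have [_ _ _ lex] := star.
pose r0 := RExp (reduced_indicator (at_of a)).
have gen_phi k : phi (gc_gen rat deg k) = restrict_val lea a (val k).
  by rewrite -os_e_val phiE ?(valP k).
have mon_phi (n : rexp deg) : phi (gc_monom deg 1 n) =
    \prod_(k <- enum K) restrict_val lea a (val k) ^+ n k.
  rewrite gc_monom_prod rmorph_prod; apply: eq_bigr => k _.
  by rewrite rmorphXn /= gen_phi.
have hom (n : rexp deg) : homogeneous_monomial (monom_deg n) (phi (gc_monom deg 1 n)).
  rewrite mon_phi /monom_deg -big_enum /=; apply: homogeneous_prod => k.
  apply: homogeneousX; rewrite /restrict_val; case: ifP => _; last by left.
  exact: homogeneous_wedge.
have sum_r0 : (\sum_k r0 k = #|at_of a|)%N.
  by rewrite -sum1_card [RHS]big_mkcond; apply: eq_bigr => k _; rewrite ffunE; case: ifP.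
have single_phi (n : rexp deg) k : expo n = single k ->
    phi (gc_monom deg 1 n) = restrict_val lea a (val k).
  by move=> ->; rewrite -gc_genE gen_phi.
have [dm phim] : monom_deg m = #|at_of a| /\ (phi (gc_monom deg 1 m))@_r0 != 0.
  have w1 : (wedge rat lea (layer lea a) (at_of a))@_r0 != 0.
    by apply: wedge_id_neq0 => t; apply: layer_id.
  have [a0|a0] := eqVneq a \bot%O.
    have m0 k : m k = 0%N.
      by rewrite Em; case: eqP => // ka; have /andP[_] := valP k; rewrite ka a0 eqxx.
    have at0 : at_of a = set0 by apply/eqP; rewrite (at_set0 LG) a0.
    rewrite /monom_deg big1 ?at0 ?cards0; last by move=> k _; rewrite m0.
    split=> //; rewrite mon_phi; rewrite big1; last by move=> k _; rewrite m0 expr0.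
    by move: w1; rewrite /wedge at0 enum_set0 big_nil.
  have ip : indep_pos a by rewrite /indep_pos ia.
  pose k0 : K := Sub a ip; have k0E : val k0 = a by [].
  have es : expo m = single k0.
    by apply/ffunP=> k; rewrite Em singleE -(val_eqE k k0) k0E.
  rewrite (monom_deg_single es) (single_phi _ _ es) k0E; split=> //.
  by rewrite /restrict_val lexx.
have others n : n \in msupp g -> n != m -> (phi (gc_monom deg 1 n))@_r0 = 0.
  move=> ng nm; apply/eqP; apply: contraT => cn.
  have := mcoeff_homogeneous (hom n) cn; rewrite sum_r0 => dn.
  have := mlead n ng nm; rewrite /monom_lt dm -dn ltnn eqxx /=.
  case/existsP=> k /andP[nmk /forall_inP H].
  have ka : val k = a by move: nmk; rewrite Em; case: eqP.
  have nk0 : n k = 0%N by move: nmk; rewrite Em ka eqxx; case: (n k).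
  have n0 j : le j k -> n j = 0%N.
    have [->//|jk] := eqVneq j k; move=> jlk.
    have := H j jk; rewrite jlk Em => /eqP->; apply/eqP; rewrite eqb0.
    by apply: contra jk => /eqP ja; apply/eqP/val_inj; rewrite ja.
  have dnk : monom_deg n = deg k by rewrite ka dn.
  have [j [es nlj djk]] := single_of_later_support dnk n0.
  move: cn; rewrite (single_phi _ _ es) /restrict_val; case: ifP => [jx cn|_]; last first.
    by rewrite mcoeff0 eqxx.
  case/negP: (nlj); apply: (lex _ _ (gen_indep _) (gen_indep _) djk); rewrite ka.
  apply: (nbc_layer_lex LG lin ia na (gen_indep j)) => //.
  - by rewrite djk ka.
  - move=> s t sj tj e; apply/eqP; apply: contraT => st.
    by move: cn; rewrite (wedge_eq0 _ _ sj tj st e) mcoeff0 eqxx.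
  - apply: contraNneq nlj => ja; rewrite (_ : j = k); last by apply: val_inj; rewrite ja.
    exact: les_refl.
have phig : phi g = \sum_(n <- msupp g) g@_n *: phi (gc_monom deg 1 n).
  by rewrite {1}(gc_expand g) raddf_sum; apply: eq_bigr => n _; apply: linearZ.
have cg : (phi g)@_r0 = g@_m * (phi (gc_monom deg 1 m))@_r0.
  rewrite phig mcoeff_sum_gc (eq_bigr (fun n => g@_n * (phi (gc_monom deg 1 n))@_r0)).
    rewrite (bigD1_seq m) ?fset_uniq //= big_seq_cond big1 ?addr0 // => n /andP[ng nm].
    by rewrite others ?mulr0.
  by move=> n _; rewrite mcoeffZ.
move/eqP: cg; rewrite (restrict_ideal LG lin phiE Jg) mcoeff0 eq_sym mulf_eq0.
by rewrite mcoeff_eq0 mg (negPf phim).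
Qed.

Lemma leading_in_ideal (g : E) (m : rexp deg) : os_ideal lea g -> m \in msupp g ->
  {in msupp g, forall n, n != m -> monom_lt le n m} ->
  ideal (leading_monoms le (os_basis lea)) (mon m).
Proof.
move=> Jg mg mlead.
have pair i j : (forall k, single i k + single j k <= m k)%N ->
    ideal (leading_monoms le (os_basis lea)) (mon m).
  move=> H; have rq : reduced deg (expD (single i) (single j)).
    by apply: reduced_le (valP m) => k; rewrite expDE.
  have [|c ->] := @monom_dvd rat K deg le m (RExp rq); first by move=> k; rewrite expDE.
  apply/ideal_mull/ideal_gen/(@leading_pair i j) => //.
  apply: contraTN rq => /andP[/eqP-> oj]; rewrite negb_forall.
  by apply/existsP; exists j; rewrite expDE !singleE eqxx oj.
have std (a : S) : indep a -> (forall k, m k = (val k == a : nat)) ->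
    ideal (leading_monoms le (os_basis lea)) (mon m).
  move=> ia Em; have [na|[t [s [tat tx cs nst]]]] := nbcP a.
    by case: (nbc_not_leading ia na Jg Em mg).
  have [w [z [uz tz dt tmin]]] := broken_circuit_unicircular LG lin ia tat tx cs nst.
  have ip : indep_pos a by rewrite -dt (indep_pos_del LG uz tz).
  pose k0 : K := Sub a ip; have k0E : val k0 = a by [].
  apply: ideal_gen; apply: (leading_circuit (k := k0) uz tz) => //.
  by apply/ffunP=> k; rewrite Em singleE -(val_eqE k k0) k0E.
have [[i [j [ij mi mj]]]|[i mi]|[k Em]|m0] := rexp_cases m.
- apply: (pair i j) => k; rewrite !singleE.
  have [->|ki] := eqVneq k i; first by rewrite (negPf ij) addn0.
  by have [->|] := eqVneq k j; rewrite ?add0n.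
- apply: (pair i i) => k; rewrite !singleE; have [->//|_] := eqVneq k i.
  by rewrite leq0n.
- by apply: (std (val k)); rewrite ?gen_indep // => j; rewrite Em singleE val_eqE.
- apply: (std \bot%O) => [|k]; first by rewrite /indep cards0; case: LG => -[_ ->].
  rewrite m0; case: eqP => // k0; by have /andP[_] := valP k; rewrite k0 eqxx.
Qed.

End GroebnerBasis.

Lemma ideal_sub (R : fieldType) (K : finType) (deg : K -> nat)
  (G H : gcalg R deg -> Prop) x :
  (forall g, G g -> ideal H g) -> ideal G x -> ideal H x.
Proof.
move=> GH; elim=> [g /GH//||g h _ ig _ ih|a g _ ig|g a _ ig].
- exact: ideal_zero.
- exact: ideal_add.
- exact: ideal_mull.
- exact: ideal_mulr.
Qed.

Theorem theorem3p2p5 (d : Order.disp_t) (P : finBPOrderType d)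
    (rho : P -> nat) (lea : rel P) (les : rel (simp rho)) :
  locally_geometric rho ->
  linear_order_on (mem (atoms rho)) lea ->
  star_order lea les ->
  groebner_basis (osgen_le les) (os_basis (rho := rho) lea) (os_ideal (rho := rho) lea).
Proof.
move=> LG lin star.
have basis_ideal g : os_basis (rho := rho) lea g -> os_ideal (rho := rho) lea g.
  case=> [[a [b [ia ib m _ ->]]]|gj|gc]; apply: ideal_gen.
  - by apply: Or31; exists a, b.
  - exact: Or32.
  - exact: Or33.
split.
- pose mono (ab : simp rho * simp rho) : osalg rho := os_e ab.1 * os_e ab.2.
  pose join (ab : simp rho * simp rho) : osalg rho := mono ab
    - os_sgn lea (at_of ab.1) (at_of ab.2) *:
        \sum_(c in joins [set ab.1; ab.2] | indep c) os_e c.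
  pose circ (zw : simp rho * simp rho) : osalg rho := \sum_(x in at_of zw.1)
    os_sgn lea [set x] (at_of (del zw.2 x)) *: os_e (del zw.2 x).
  pose pairs := enum [set: simp rho * simp rho].
  exists (map mono pairs ++ map join pairs ++ map circ pairs) => g; rewrite !mem_cat.
  have inP ab : ab \in pairs by rewrite mem_enum inE.
  case=> [[a [b [_ _ _ _ ->]]]|[a [b [_ _ _ ->]]]|[z [w [_ ->]]]]; apply/or3P.
  - by apply: Or31; apply/mapP; exists (a, b).
  - by apply: Or32; apply/mapP; exists (a, b).
  - by apply: Or33; apply/mapP; exists (z, w).
- move=> x; split; first exact: ideal_sub.
  apply: ideal_sub => g [[a [b [ia ib m ->]]]|gj|gc].
  + have [/andP[/eqP ab oa]|nz] := boolP ((a == b) && odd #|at_of a|).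
      rewrite -ab (os_eE ia) -expr2 gc_gen_odd ?SubK //; exact: ideal_zero.
    by apply: ideal_gen; apply: Or31; exists a, b.
  + by apply: ideal_gen; apply: Or32.
  + by apply: ideal_gen; apply: Or33.
- move=> x; split.
    apply: ideal_sub => M [g [gG g0 lm]]; apply: ideal_gen; exists g; split=> //.
    exact: basis_ideal.
  apply: ideal_sub => M [g [Jg _ [m [mg mlead ->]]]].
  exact: leading_in_ideal Jg mg mlead.
Qed.
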